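(* Assume, in the standing setting, that $\mathbf A^{\sharp}\mathbf A\in\mathrm M(n,\mathbb H)$ and $\mathbf B\mathbf B^{\sharp}\in\mathrm M(p,\mathbb H)$ are both Hermitian. Put $\widetilde{\mathbf D}=\mathbf A^{\sharp}\mathbf D\mathbf B^{\sharp}=(\widetilde d_{kl})\in\mathbb H^{n\times p}$, with rows $\widetilde{\mathbf d}_{k.}$ and columns $\widetilde{\mathbf d}_{.l}$. Then for all $i=1,\dots,n$, $j=1,\dots,p$ the entries of $\mathbf X=\mathbf A^{\dagger}_{M,N}\mathbf D\mathbf B^{\dagger}_{P,Q}$ satisfy: (i) If $r_1<n$ and $r_2<p$: let $\mathbf d^{\mathbf B}_{.j}\in\mathbb H^{n\times1}$ have $k$-th entry $\sum_{\alpha\in I_{r_2,p}\{j\}}\operatorname{rdet}_j\big((\mathbf B\mathbf B^{\sharp})_{j.}(\widetilde{\mathbf d}_{k.})\big)^{\alpha}_{\alpha}$ and $\mathbf d^{\mathbf A}_{i.}\in\mathbb H^{1\times p}$ have $l$-th entry $\sum_{\beta\in J_{r_1,n}\{i\}}\operatorname{cdet}_i\big((\mathbf A^{\sharp}\mathbf A)_{.i}(\widetilde{\mathbf d}_{.l})\big)^{\beta}_{\beta}$. With $\Delta=\sum_{\beta\in J_{r_1,n}}\det\big((\mathbf A^{\sharp}\mathbf A)^{\beta}_{\beta}\big)\cdot\sum_{\alpha\in I_{r_2,p}}\det\big((\mathbf B\mathbf B^{\sharp})^{\alpha}_{\alpha}\big)$, $$x_{ij}=\frac{\sum_{\beta\in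 J_{r_1,n}\{i\}}\operatorname{cdet}_i\big((\mathbf A^{\sharp}\mathbf A)_{.i}(\mathbf d^{\mathbf B}_{.j})\big)^{\beta}_{\beta}}{\Delta}=\frac{\sum_{\alpha\in I_{r_2,p}\{j\}}\operatorname{rdet}_j\big((\mathbf B\mathbf B^{\sharp})_{j.}(\mathbf d^{\mathbf A}_{i.})\big)^{\alpha}_{\alpha}}{\Delta}.$$ (ii) If $r_1=n$ and $r_2=p$: let $\mathbf d^{\mathbf B}_{.j}$ have $k$-th entry $\operatorname{rdet}_j(\mathbf B\mathbf B^{\sharp})_{j.}(\widetilde{\mathbf d}_{k.})$ and $\mathbf d^{\mathbf A}_{i.}$ have $l$-th entry $\operatorname{cdet}_i(\mathbf A^{\sharp}\mathbf A)_{.i}(\widetilde{\mathbf d}_{.l})$. Then $$x_{ij}=\frac{\operatorname{cdet}_i(\mathbf A^{\sharp}\mathbf A)_{.i}(\mathbf d^{\mathbf B}_{.j})}{\det(\mathbf A^{\sharp}\mathbf A)\det(\mathbf B\mathbf B^{\sharp})}=\frac{\operatorname{rdet}_j(\mathbf B\mathbf B^{\sharp})_{j.}(\mathbf d^{\mathbf A}_{i.})}{\det(\mathbf A^{\sharp}\mathbf A)\det(\mathbf B\mathbf B^{\sharp})}.$$ (iii) If $r_1=n$ and $r_2<p$: with $\mathbf d^{\mathbf B}_{.j}$ defined as in (i) and $\mathbf d^{\mathbf A}_{i.}$ defined as in (ii), $$x_{ij}=\frac{\operatorname{cdet}_i(\mathbf A^{\sharp}\mathbf A)_{.i}(\mathbf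 d^{\mathbf B}_{.j})}{\det(\mathbf A^{\sharp}\mathbf A)\sum_{\alpha\in I_{r_2,p}}\det((\mathbf B\mathbf B^{\sharp})^{\alpha}_{\alpha})}=\frac{\sum_{\alpha\in I_{r_2,p}\{j\}}\operatorname{rdet}_j\big((\mathbf B\mathbf B^{\sharp})_{j.}(\mathbf d^{\mathbf A}_{i.})\big)^{\alpha}_{\alpha}}{\det(\mathbf A^{\sharp}\mathbf A)\sum_{\alpha\in I_{r_2,p}}\det((\mathbf B\mathbf B^{\sharp})^{\alpha}_{\alpha})}.$$ (iv) If $r_1<n$ and $r_2=p$: with $\mathbf d^{\mathbf B}_{.j}$ defined as in (ii) and $\mathbf d^{\mathbf A}_{i.}$ defined as in (i), $$x_{ij}=\frac{\operatorname{rdet}_j(\mathbf B\mathbf B^{\sharp})_{j.}(\mathbf d^{\mathbf A}_{i.})}{\sum_{\beta\in J_{r_1,n}}\det((\mathbf A^{\sharp}\mathbf A)^{\beta}_{\beta})\det(\mathbf B\mathbf B^{\sharp})}=\frac{\sum_{\beta\in J_{r_1,n}\{i\}}\operatorname{cdet}_i\big((\mathbf A^{\sharp}\mathbf A)_{.i}(\mathbf d^{\mathbf B}_{.j})\big)^{\beta}_{\beta}}{\sum_{\beta\in J_{r_1,n}}\det((\mathbf A^{\sharp}\mathbf A)^{\beta}_{\beta})\det(\mathbf B\mathbf B^{\sharp})}.$$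
   Context: $\mathbb H$ is the real quaternion skew field; $\mathbb H^{m\times n}$ the $m\times n$ quaternion matrices; $\mathrm M(n,\mathbb H)=\mathbb H^{n\times n}$; $\mathbf C^*$ the conjugate transpose; rank is the maximal number of right-linearly independent columns. A square $\mathbf H$ is Hermitian if $\mathbf H^*=\mathbf H$, positive definite if also $\mathbf x^*\mathbf H\mathbf x>0$ for all nonzero $\mathbf x$. For Hermitian positive definite $\mathbf H$, $\mathbf H^{1/2}$ is its unique Hermitian positive definite square root and $\mathbf H^{-1/2}=(\mathbf H^{1/2})^{-1}$. Row and column determinants of $\mathbf C=(c_{ij})\in\mathrm M(n,\mathbb H)$: for $i\in\{1,\dots,n\}$, write each $\sigma\in S_n$ as a product of $r$ disjoint cycles (fixed points included) as $\sigma=(i\,i_{k_1}\,i_{k_1+1}\dots i_{k_1+l_1})(i_{k_2}\dots i_{k_2+l_2})\cdots(i_{k_r}\dots i_{k_r+l_r})$, where the first cycle contains $i$ and starts with $i$, every other cycle starts with its smallest element, and $i_{k_2}<\dots<i_{k_r}$; then $\operatorname{rdet}_i\mathbf C=\sum_{\sigma\in S_n}(-1)^{n-r}(c_{i\,i_{k_1}}c_{i_{k_1}i_{k_1+1}}\cdots c_{i_{k_1+l_1}\,i})\cdots(c_{i_{k_r}i_{k_r+1}}\cdots c_{i_{k_r+l_r}i_{k_r}})$. For $j\in\{1,\dots,n\}$, write each $\tau\in S_n$ as $\tau=(j_{k_r+l_r}\dots j_{k_r+1}j_{k_r})\cdots(j_{k_2+l_2}\dots j_{k_2})(j_{k_1+l_1}\dots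 j_{k_1+1}j_{k_1}\,j)$, where the last cycle contains $j$ and ends with $j$, every other cycle ends with its smallest element, and $j_{k_2}<\dots<j_{k_r}$; then $\operatorname{cdet}_j\mathbf C=\sum_{\tau\in S_n}(-1)^{n-r}(c_{j_{k_r}j_{k_r+l_r}}\cdots c_{j_{k_r+1}j_{k_r}})\cdots(c_{j\,j_{k_1+l_1}}\cdots c_{j_{k_1+1}j_{k_1}}c_{j_{k_1}j})$. For Hermitian $\mathbf C$ all $\operatorname{rdet}_i\mathbf C$ and $\operatorname{cdet}_j\mathbf C$ coincide and are real; this common value is $\det\mathbf C$. Notation: $\mathbf c_{.j}$, $\mathbf c_{i.}$ are the $j$-th column and $i$-th row of $\mathbf C$; $\mathbf C_{.j}(\mathbf b)$ (resp. $\mathbf C_{i.}(\mathbf b)$) is $\mathbf C$ with its $j$-th column (resp. $i$-th row) replaced by $\mathbf b$. $\mathbf C^{\alpha}_{\beta}$ is the submatrix with rows indexed by $\alpha$ and columns by $\beta$. $L_{k,n}$ is the set of strictly increasing sequences of $k$ integers from $\{1,\dots,n\}$; $I_{r,m}\{i\}=\{\alpha\in L_{r,m}: i\in\alpha\}$, $J_{r,n}\{j\}=\{\beta\in L_{r,n}: j\in\beta\}$, and $I_{r,m}=L_{r,m}$, $J_{r,n}=L_{r,n}$. For $i\in\beta$, $\operatorname{cdet}_i(\mathbf C_{.i}(\mathbf b))^{\beta}_{\beta}$ is the column determinant of the square matrix $(\mathbf C_{.i}(\mathbf b))^{\beta}_{\beta}$ with respect to its column corresponding to index $i$; similarly $\operatorname{rdet}_j(\mathbf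 C_{j.}(\mathbf b))^{\alpha}_{\alpha}$ for $j\in\alpha$ with respect to the row corresponding to $j$. Weighted Moore–Penrose inverse: for $\mathbf A\in\mathbb H^{m\times n}$ and Hermitian positive definite $\mathbf M$ (order $m$), $\mathbf N$ (order $n$), $\mathbf A^{\dagger}_{M,N}$ is the unique $\mathbf Y\in\mathbb H^{n\times m}$ with $\mathbf A\mathbf Y\mathbf A=\mathbf A$, $\mathbf Y\mathbf A\mathbf Y=\mathbf Y$, $(\mathbf M\mathbf A\mathbf Y)^*=\mathbf M\mathbf A\mathbf Y$, $(\mathbf N\mathbf Y\mathbf A)^*=\mathbf N\mathbf Y\mathbf A$. Standing setting: $\mathbf A\in\mathbb H^{m\times n}$ of rank $r_1\ge1$, $\mathbf B\in\mathbb H^{p\times q}$ of rank $r_2\ge1$, $\mathbf D\in\mathbb H^{m\times q}$; $\mathbf M,\mathbf N,\mathbf P,\mathbf Q$ Hermitian positive definite of orders $m,n,p,q$. $\mathbf A^{\sharp}=\mathbf N^{-1}\mathbf A^*\mathbf M$, $\mathbf B^{\sharp}=\mathbf Q^{-1}\mathbf B^*\mathbf P$, $\widetilde{\mathbf A}=\mathbf M^{1/2}\mathbf A\mathbf N^{-1/2}$, $\widetilde{\mathbf B}=\mathbf P^{1/2}\mathbf B\mathbf Q^{-1/2}$; $n^{(-1/2)}_{ik}$ are the entries of $\mathbf N^{-1/2}$ and $p^{(1/2)}_{lj}$ those of $\mathbf P^{1/2}$. $\mathbf X=(x_{ij}):=\mathbf A^{\dagger}_{M,N}\mathbf D\mathbf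 B^{\dagger}_{P,Q}\in\mathbb H^{n\times p}$ (this is the unique solution of $\mathbf A\mathbf X\mathbf B=\mathbf D$ under the paper's range restrictions). *)

(* Defs.v *)
From Stdlib Require Import Ring.
From HB Require Import structures.
From mathcomp Require Import all_boot all_order all_algebra all_fingroup.
Set Implicit Arguments. Unset Strict Implicit. Unset Printing Implicit Defensive.
Import Order.TTheory GRing.Theory Num.Theory.
Local Open Scope ring_scope.

Section Quat.
Variable R : comNzRingType.

Definition radd (x y : R) : R := x + y.
Definition rmul (x y : R) : R := x * y.
Definition ropp (x : R) : R := - x.
Definition rsub (x y : R) : R := x - y.
Definition r0 : R := 0.
Definition r1 : R := 1.
Arguments radd : simpl never. Arguments rmul : simpl never.
Arguments ropp : simpl never. Arguments rsub : simpl never.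

Lemma RRth : @ring_theory R r0 r1 radd rmul rsub ropp eq.
Proof.
rewrite /r0 /r1 /radd /rmul /rsub /ropp.
split=> //; [exact: add0r|exact: addrC|exact: addrA|exact: mul1r|exact: mulrC
  |exact: mulrA|exact: mulrDl|exact: subrr].
Qed.
Add Ring RRing : RRth.

Record quat := Quat { qre : R; qi : R; qj : R; qk : R }.

Definition quat_tuple (x : quat) := (qre x, qi x, qj x, qk x).
Definition tuple_quat (t : R * R * R * R) :=
  let: (a, b, c, d) := t in Quat a b c d.
Lemma quat_tupleK : cancel quat_tuple tuple_quat. Proof. by case. Qed.

HB.instance Definition _ := Equality.copy quat (can_type quat_tupleK).
HB.instance Definition _ := Choice.copy quat (can_type quat_tupleK).

Definition qadd x y :=
  Quat (radd (qre x) (qre y)) (radd (qi x) (qi y)) (radd (qj x) (qj y)) (radd (qk x) (qk y)).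
Definition qopp x := Quat (ropp (qre x)) (ropp (qi x)) (ropp (qj x)) (ropp (qk x)).
Definition qzero := Quat r0 r0 r0 r0.
Definition qone := Quat r1 r0 r0 r0.
Definition qmul x y := Quat
  (rsub (rsub (rsub (rmul (qre x) (qre y)) (rmul (qi x) (qi y))) (rmul (qj x) (qj y))) (rmul (qk x) (qk y)))
  (rsub (radd (radd (rmul (qre x) (qi y)) (rmul (qi x) (qre y))) (rmul (qj x) (qk y))) (rmul (qk x) (qj y)))
  (radd (radd (rsub (rmul (qre x) (qj y)) (rmul (qi x) (qk y))) (rmul (qj x) (qre y))) (rmul (qk x) (qi y)))
  (radd (rsub (radd (rmul (qre x) (qk y)) (rmul (qi x) (qj y))) (rmul (qj x) (qi y))) (rmul (qk x) (qre y))).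

Lemma quatP x y : qre x = qre y -> qi x = qi y -> qj x = qj y -> qk x = qk y -> x = y.
Proof. by case: x; case: y => /= ???? ???? -> -> -> ->. Qed.

Lemma qaddA : associative qadd.
Proof. by move=> x y z; apply: quatP => /=; ring. Qed.
Lemma qaddC : commutative qadd.
Proof. by move=> x y; apply: quatP => /=; ring. Qed.
Lemma qadd0 : left_id qzero qadd.
Proof. by move=> x; apply: quatP => /=; ring. Qed.
Lemma qaddN : left_inverse qzero qopp qadd.
Proof. by move=> x; apply: quatP => /=; ring. Qed.
HB.instance Definition _ := GRing.isZmodule.Build quat qaddA qaddC qadd0 qaddN.

Lemma qmulA : associative qmul.
Proof. by move=> x y z; apply: quatP => /=; ring. Qed.
Lemma qmul1 : left_id qone qmul.
Proof. by move=> x; apply: quatP => /=; ring. Qed.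
Lemma qmulr1 : right_id qone qmul.
Proof. by move=> x; apply: quatP => /=; ring. Qed.
Lemma qmulDl : left_distributive qmul qadd.
Proof. by move=> x y z; apply: quatP => /=; ring. Qed.
Lemma qmulDr : right_distributive qmul qadd.
Proof. by move=> x y z; apply: quatP => /=; ring. Qed.
Lemma qone_neq0 : qone != qzero.
Proof. by apply/eqP => -[] /eqP; rewrite /r1 /r0 oner_eq0. Qed.
HB.instance Definition _ := GRing.Zmodule_isNzRing.Build quat qmulA qmul1 qmulr1 qmulDl qmulDr qone_neq0.
End Quat.

(* Quaternion matrices over a real closed field R (the paper: R = reals) *)
Section QMx.
Variable R : rcfType.
Local Notation H := (quat R).

Definition qconj (x : H) : H := Quat (qre x) (- qi x) (- qj x) (- qk x).
Definition qreal (r : R) : H := Quat r 0 0 0.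

Definition adjq m n (C : 'M[H]_(m, n)) : 'M[H]_(n, m) := (map_mx qconj C)^T.

Definition hermq n (C : 'M[H]_n) : Prop := adjq C = C.

Definition posdefq n (C : 'M[H]_n) : Prop :=
  hermq C /\
  forall x : 'cV[H]_n, x != 0 ->
    let z := (adjq x *m C *m x) ord0 ord0 in
    [/\ qi z = 0, qj z = 0, qk z = 0 & 0 < qre z].

Definition inverse_of n (C Ci : 'M[H]_n) : Prop :=
  C *m Ci = 1%:M /\ Ci *m C = 1%:M.

Definition rindep m n (C : 'M[H]_(m, n)) (S : {set 'I_n}) : Prop :=
  forall c : 'I_n -> H,
    (forall i : 'I_m, \sum_(j in S) C i j * c j = 0) ->
    forall j, j \in S -> c j = 0.

Definition qrank_is m n (C : 'M[H]_(m, n)) (r : nat) : Prop :=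
  (exists S : {set 'I_n}, rindep C S /\ #|S| = r) /\
  (forall S : {set 'I_n}, rindep C S -> (#|S| <= r)%N).

Definition wmp_inv m n (M : 'M[H]_m) (N : 'M[H]_n) (A : 'M[H]_(m, n))
  (Y : 'M[H]_(n, m)) : Prop :=
  [/\ A *m Y *m A = A, Y *m A *m Y = Y,
      adjq (M *m A *m Y) = M *m A *m Y & adjq (N *m Y *m A) = N *m Y *m A].

Definition cyc_prod n (C : 'M[H]_n) (s : 'S_n) (x : 'I_n) : H :=
  \prod_(k < #|porbit s x|) C ((s ^+ k)%g x) ((s ^+ k.+1)%g x).

Definition cyc_min n (s : 'S_n) (x : 'I_n) : bool :=
  [forall y in porbit s x, (x <= y)%N].

(* rdet_i : first the cycle of i starting at i, then the other cycles,
   each starting at its smallest element, by increasing smallest elements *)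
Definition rdetq n (i : 'I_n) (C : 'M[H]_n) : H :=
  \sum_(s : 'S_n) (-1) ^+ (n - #|porbits s|) *
    (cyc_prod C s i *
     \prod_(x <- enum 'I_n | cyc_min s x && (x \notin porbit s i)) cyc_prod C s x).

(* cdet_j : the other cycles, each ending with its smallest element, by
   decreasing smallest elements, and last the cycle of j ending with j *)
Definition cdetq n (j : 'I_n) (C : 'M[H]_n) : H :=
  \sum_(s : 'S_n) (-1) ^+ (n - #|porbits s|) *
    (\prod_(x <- rev (enum 'I_n) | cyc_min s x && (x \notin porbit s j))
        cyc_prod C s x * cyc_prod C s j).

(* det of a Hermitian matrix: the common real value of rdet_i / cdet_j,
   here read off rdet_1 *)
Definition hdetq n : 'M[H]_n -> R :=
  match n return 'M[H]_n -> R with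
  | 0 => fun _ => 1
  | n'.+1 => fun C => qre (rdetq ord0 C)
  end.

(* principal submatrix C^b_b, b listed increasingly *)
Definition subq n (C : 'M[H]_n) (b : {set 'I_n}) : 'M[H]_#|b| :=
  \matrix_(u, v) C (enum_val u) (enum_val v).

(* rdet_i (C)^b_b w.r.t. the row corresponding to index i (0 if i \notin b) *)
Definition rdet_subq n (C : 'M[H]_n) (b : {set 'I_n}) (i : 'I_n) : H :=
  if (insub (index i (enum b)) : option 'I_#|b|) is Some i'
  then rdetq i' (subq C b) else 0.

Definition cdet_subq n (C : 'M[H]_n) (b : {set 'I_n}) (i : 'I_n) : H :=
  if (insub (index i (enum b)) : option 'I_#|b|) is Some i'
  then cdetq i' (subq C b) else 0.

Definition colrep n (C : 'M[H]_n) (i : 'I_n) (v : 'cV[H]_n) : 'M[H]_n :=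
  \matrix_(r, c) if c == i then v r ord0 else C r c.
Definition rowrep n (C : 'M[H]_n) (j : 'I_n) (v : 'rV[H]_n) : 'M[H]_n :=
  \matrix_(r, c) if r == j then v ord0 c else C r c.

Definition sum_pminors n (C : 'M[H]_n) (r : nat) : R :=
  \sum_(b : {set 'I_n} | #|b| == r) hdetq (subq C b).

Definition dB_sub n p (BB : 'M[H]_p) (Dt : 'M[H]_(n, p)) (r2 : nat) (j : 'I_p)
  : 'cV[H]_n :=
  \col_k \sum_(a : {set 'I_p} | (#|a| == r2) && (j \in a))
           rdet_subq (rowrep BB j (row k Dt)) a j.
Definition dB_full n p (BB : 'M[H]_p) (Dt : 'M[H]_(n, p)) (j : 'I_p) : 'cV[H]_n :=
  \col_k rdetq j (rowrep BB j (row k Dt)).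

Definition dA_sub n p (AA : 'M[H]_n) (Dt : 'M[H]_(n, p)) (r1 : nat) (i : 'I_n)
  : 'rV[H]_p :=
  \row_l \sum_(b : {set 'I_n} | (#|b| == r1) && (i \in b))
           cdet_subq (colrep AA i (col l Dt)) b i.
Definition dA_full n p (AA : 'M[H]_n) (Dt : 'M[H]_(n, p)) (i : 'I_n) : 'rV[H]_p :=
  \row_l cdetq i (colrep AA i (col l Dt)).

End QMx.

(* Main.v *)
Require Import Defs.
From HB Require Import structures.
From mathcomp Require Import all_boot all_order all_algebra all_fingroup.
From mathcomp Require Import ring lra.
Set Implicit Arguments. Unset Strict Implicit. Unset Printing Implicit Defensive.
Import Order.TTheory GRing.Theory Num.Theory.
Local Open Scope ring_scope.

(** For a Hermitian quaternion matrix [G] and a set [T] of indices, let [mdet G T]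
be the sum over the permutations [s] of [T] of the sign of [s] times the product
of the real parts of its cycle products, and let [padj T i k] be the signed sum
over the simple paths from [i] to [k] in [T] of the path product times [mdet] of
the rest of [T].  Removing the last, or the first, vertex of a path gives two
recursions for [padj], from which [padj T] is a left adjugate of [G] on [T]; since
[cdetq] obeys the same recursion with the ordered cycle products in place of their
real parts, column determinants with one replaced column are rows of [padj T]
applied to that column.  Row determinants follow by conjugate transposition.

Summing [padj T] over the sets [T] of size [r] gives a matrix [L r], and the
recursion becomes the Faddeev-LeVerrier identity [L (r+1) + L r G = d r], where
[d r] is the sum of the principal minors of order [r].  If [r] is the largest order
with [d r <> 0], then [L r G / d r] is the Hermitian projection onto the range of
[G], with trace [r]; comparing traces, [r] is the rank of [G].  Hence
[L r G G = d r G] at the rank, and since [A^# = (A^# A) Y] and [Y] has its range in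
that of [A^# A], where [Y] is the weighted inverse of [A], this yields
[L r A^# = d r Y], and symmetrically for [B]. *)

(** * Real part and conjugation of quaternions *)

Section Quaternions.
Variable R : rcfType.
Local Notation H := (quat R).
Implicit Types x y z : H.

Lemma qre_sum (I : Type) (r : seq I) (P : pred I) (F : I -> H) :
  qre (\sum_(i <- r | P i) F i) = \sum_(i <- r | P i) qre (F i).
Proof. by elim/big_rec2: _ => // i a b _ <-. Qed.

Lemma qreMC x y : qre (x * y) = qre (y * x).
Proof. by rewrite /= /rsub /rmul; ring. Qed.

Lemma qconjD x y : qconj (x + y) = qconj x + qconj y.
Proof. by apply: quatP => //=; rewrite /radd opprD. Qed.

Lemma qconjN x : qconj (- x) = - qconj x.
Proof. by []. Qed.

Lemma qconj0 : qconj (0 : H) = 0.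
Proof. by apply: quatP => //=; rewrite /r0 oppr0. Qed.

Lemma qconj1 : qconj (1 : H) = 1.
Proof. by apply: quatP => //=; rewrite /r0 oppr0. Qed.

Lemma qconjM x y : qconj (x * y) = qconj y * qconj x.
Proof. by apply: quatP => /=; rewrite /radd /rsub /rmul; ring. Qed.

Lemma qconjK : involutive (@qconj R).
Proof. by move=> x; apply: quatP => //=; rewrite opprK. Qed.

Lemma qconj_sum (I : Type) (r : seq I) (P : pred I) (F : I -> H) :
  qconj (\sum_(i <- r | P i) F i) = \sum_(i <- r | P i) qconj (F i).
Proof. exact: (big_morph _ qconjD qconj0). Qed.

Lemma qre_conj x : qre (qconj x) = qre x. Proof. by []. Qed.

Lemma qrealD (a b : R) : qreal (a + b) = qreal a + qreal b.
Proof. by apply: quatP => //=; rewrite /radd addr0. Qed.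

Lemma qrealN (a : R) : qreal (- a) = - qreal a.
Proof. by apply: quatP => //=; rewrite /ropp oppr0. Qed.

Lemma qrealM (a b : R) : qreal (a * b) = qreal a * qreal b.
Proof. by apply: quatP => /=; rewrite /radd /rsub /rmul; ring. Qed.

Lemma qreal0 : qreal (0 : R) = 0. Proof. by []. Qed.
Lemma qreal1 : qreal (1 : R) = 1. Proof. by []. Qed.

Lemma qreal_sum (I : Type) (r : seq I) (P : pred I) (F : I -> R) :
  qreal (\sum_(i <- r | P i) F i) = \sum_(i <- r | P i) qreal (F i).
Proof. exact: (big_morph _ qrealD qreal0). Qed.

Lemma qreal_prod (I : Type) (r : seq I) (P : pred I) (F : I -> R) :
  qreal (\prod_(i <- r | P i) F i) = \prod_(i <- r | P i) qreal (F i).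
Proof. exact: (big_morph _ qrealM qreal1). Qed.

Lemma qreal_sign (b : bool) : qreal ((-1) ^+ b : R) = (-1) ^+ b.
Proof. by case: b; rewrite ?expr1 ?expr0 // qrealN. Qed.

Lemma qrealC (a : R) x : qreal a * x = x * qreal a.
Proof. by apply: quatP => /=; rewrite /radd /rsub /rmul; ring. Qed.

Lemma qconj_real (a : R) : qconj (qreal a) = qreal a.
Proof. by apply: quatP => //=; rewrite oppr0. Qed.

Lemma qreM_real (a : R) x : qre (qreal a * x) = a * qre x.
Proof. by rewrite /= /rsub /rmul; ring. Qed.

Lemma qconj_fixed x : qconj x = x -> x = qreal (qre x).
Proof.
have half (a : R) : - a = a -> a = 0 by move=> h; lra.
move=> h; apply: quatP => //=; apply: half.
- by have := congr1 (@qi _) h.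
- by have := congr1 (@qj _) h.
- by have := congr1 (@qk _) h.
Qed.

Lemma qnorm_ge0 x : 0 <= qre (x * qconj x).
Proof.
rewrite (_ : qre _ = qre x ^+ 2 + qi x ^+ 2 + qj x ^+ 2 + qk x ^+ 2).
  by rewrite !addr_ge0 ?sqr_ge0.
by rewrite /= /rsub /rmul; ring.
Qed.

Lemma qnorm_eq0 x : qre (x * qconj x) = 0 -> x = 0.
Proof.
rewrite (_ : qre _ = qre x ^+ 2 + qi x ^+ 2 + qj x ^+ 2 + qk x ^+ 2); last first.
  by rewrite /= /rsub /rmul; ring.
move/eqP; rewrite !paddr_eq0 ?addr_ge0 ?sqr_ge0 // !sqrf_eq0.
by move=> /andP[/andP[/andP[/eqP ? /eqP ?] /eqP ?] /eqP ?]; apply: quatP.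
Qed.

End Quaternions.

(** * Cycle and path expansions *)

Section CyclePaths.
Variables (R : rcfType) (n : nat) (phi : quat R -> quat R) (G : 'M[quat R]_n).
Implicit Types (T : {set 'I_n}) (s : 'S_n) (i j k x : 'I_n).

(* The weight [phi] put on the cycles avoiding [i] is the identity for column
   determinants and the real part for [mdet]. *)
Definition pathprod s i :=
  \prod_(k < #|porbit s i|.-1) G ((s ^+ k)%g i) ((s ^+ k.+1)%g i).

Definition other_cycles T s i :=
  \prod_(x <- rev (enum 'I_n) | [&& x \in T, cyc_min s x & x \notin porbit s i])
     phi (cyc_prod G s x).

(** A permutation [s] of [T] with [s k = i] encodes a simple path from [i] to [k], namely the cycle
    of [i] cut open before its closing edge, together with a permutation of the remaining
    indices. *)
Definition padj T i k :=
  \sum_(s | perm_on T s && (s k == i))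
     (-1) ^+ s * (other_cycles T s i * pathprod s i).

Definition pdet T :=
  \sum_(s | perm_on T s)
     (-1) ^+ s *
     \prod_(x <- rev (enum 'I_n) | (x \in T) && cyc_min s x) phi (cyc_prod G s x).

Lemma iter_perm_card_porbit s i : (s ^+ #|porbit s i|)%g i = i.
Proof. by rewrite permX iter_porbit. Qed.

Lemma expg_card_porbit_pred s i : (s ^+ #|porbit s i|.-1)%g i = (s^-1)%g i.
Proof.
apply: (@perm_inj _ s); rewrite permKV -[RHS](iter_perm_card_porbit s i).
have: (0 < #|porbit s i|)%N by apply/card_gt0P; exists i; apply: porbit_id.
by case: #|_| => // m _; rewrite expgSr permM.
Qed.

(** The cycle of [i], read from [i], enters column [i] only with its closing factor, so replacing
    that column of [G] changes no other factor. *)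
Lemma cyc_prod_path s i (C : 'M_n) :
  (forall r c, c != i -> C r c = G r c) ->
  cyc_prod C s i = pathprod s i * C ((s^-1)%g i) i.
Proof.
move=> hC; rewrite /cyc_prod /pathprod -expg_card_porbit_pred.
have := iter_perm_card_porbit s i.
have: (0 < #|porbit s i|)%N by apply/card_gt0P; exists i; apply: porbit_id.
have := uniq_traject_porbit s i.
case: #|_| => // m uT _ hm; rewrite big_ord_recr /= hm; congr (_ * _).
(* An earlier factor in column [i] would make [i] occur twice in one turn of the orbit. *)
apply: eq_bigr => k _; apply: hC; apply/negP => /eqP /esym h.
have := uT; rewrite /= => /andP[/negP[]].
rewrite {}[in X in X \in _]h; apply/trajectP; exists k => //.
by rewrite permX iterSr.
Qed.

Lemma padj_diag T i : i \in T -> padj T i i = pdet (T :\ i).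
Proof.
move=> iT; rewrite /padj /pdet; apply: eq_big => [s|s /andP[_ /eqP si]].
  apply/andP/idP => [[/subsetP sT /eqP si]|sT].
    apply/subsetP => x; rewrite !inE => sx; rewrite [_ \in T]sT ?andbT //.
    by apply: contra_neq sx => ->.
  split; first by apply: subset_trans sT (subD1set _ _).
  by apply/eqP/(out_perm sT); rewrite !inE eqxx.
have oi : porbit s i = [set i].
  apply/setP => x; rewrite inE; apply/porbitP/eqP => [[m ->]|->].
    by rewrite permX; elim: m => // m IH; rewrite iterS IH.
  by exists 0%N; rewrite expg0 perm1.
congr (_ * _); rewrite /pathprod oi cards1 big_ord0 mulr1 /other_cycles.
apply: eq_bigl => x; rewrite oi !inE.
by case: (x \in T); case: (x == i); rewrite ?andbT ?andbF.
Qed.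

(* If [s] fixes [k], then [s * tperm i k] inserts [k] just before [i] in the cycle
   of [i]. *)
Section RemoveLast.
Variables (s : 'S_n) (i k : 'I_n).
Hypotheses (sk : s k = k) (ki : k != i).
Let t := (s * tperm i k)%g.

Lemma fixed_notin_porbit : k \notin porbit s i.
Proof.
rewrite porbit_sym; apply/negP => /porbitP[m h]; case/eqP: ki; rewrite h permX.
by elim: m {h} => // m IH; rewrite iterS -IH.
Qed.

Lemma insert_iter m : (m < #|porbit s i|)%N -> iter m t i = iter m s i.
Proof.
elim: m => // m IH mlt; rewrite !iterS IH ?(ltnW mlt) // /t permM tpermD //.
  have := uniq_traject_porbit s i; case: #|_| mlt => // c mlt /= /andP[+ _].
  apply: contra => /eqP h; rewrite [X in X \in _]h.
  by apply/trajectP; exists m => //; rewrite -iterS iterSr.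
apply: contra fixed_notin_porbit => /eqP ->.
by rewrite -iterS -permX mem_porbit.
Qed.

Lemma insert_iter_card : iter #|porbit s i| t i = k.
Proof.
have: (0 < #|porbit s i|)%N by apply/card_gt0P; exists i; apply: porbit_id.
case E: #|porbit s i| => [//|m] _; rewrite iterS insert_iter ?E // /t permM.
by rewrite -iterS -E iter_porbit tpermL.
Qed.

Lemma insert_porbit : porbit t i = k |: porbit s i.
Proof.
apply/setP => x; rewrite in_setU1; apply/idP/orP => [/porbitP[m ->]|[/eqP->|]].
- rewrite permX; elim: m => [|m IH]; first by right; apply: porbit_id.
  rewrite iterS; set y := iter m t i in IH *; rewrite /t permM.
  case: IH => [/eqP->|yo]; first by rewrite sk tpermR; right; apply: porbit_id.
  case: tpermP => _; [by left|by right; apply: porbit_id|right].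
  by case/porbitP: yo => a ->; rewrite -permM -expgSr mem_porbit.
- by rewrite -[X in X \in _]insert_iter_card -permX mem_porbit.
- rewrite porbit_traject => /trajectP[m mlt ->].
  by rewrite -insert_iter // -permX mem_porbit.
Qed.

Lemma insert_card_porbit : #|porbit t i| = #|porbit s i|.+1.
Proof. by rewrite insert_porbit cardsU1 fixed_notin_porbit. Qed.

Lemma insert_pathprod : pathprod t i = pathprod s i * G ((s^-1)%g i) k.
Proof.
rewrite /pathprod insert_card_porbit /= -expg_card_porbit_pred.
have := insert_iter; have := insert_iter_card.
have: (0 < #|porbit s i|)%N by apply/card_gt0P; exists i; apply: porbit_id.
case: #|_| => // m _ hk hi; rewrite big_ord_recr /=; congr (_ * _).
  by apply: eq_bigr => c _; rewrite !permX !hi // ltnS // ltnW.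
by rewrite !permX hk hi.
Qed.

Lemma insert_iter_out x m : x \notin porbit t i -> iter m t x = iter m s x.
Proof.
move=> xo; elim: m => // m IH; rewrite !iterS IH {1}/t permM tpermD //.
  apply: contra xo => /eqP h; rewrite insert_porbit in_setU1; apply/orP; right.
  by rewrite porbit_sym; rewrite [X in X \in _]h -iterS -permX mem_porbit.
apply: contra xo => /eqP h; suff -> : x = k.
  by rewrite insert_porbit in_setU1 eqxx.
apply: (@perm_inj _ (s ^+ m.+1)%g); rewrite permX iterS -h permX.
by elim: (m.+1) => // c IHc; rewrite iterS -IHc.
Qed.

Lemma insert_porbit_out x : x \notin porbit t i -> porbit t x = porbit s x.
Proof.
move=> xo; apply/setP => y; apply/porbitP/porbitP => -[m ->]; exists m;
  by rewrite !permX insert_iter_out.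
Qed.

Lemma insert_cyc_prod x : x \notin porbit t i -> cyc_prod G t x = cyc_prod G s x.
Proof.
move=> xo; rewrite /cyc_prod insert_porbit_out //.
by apply: eq_bigr => m _; rewrite !permX !insert_iter_out.
Qed.

(** The vertex [k] is a one-element cycle of [s] but lies on the cycle of [i] in [t], hence its
    removal from [T] on the right. *)
Lemma insert_other_cycles T : other_cycles T t i = other_cycles (T :\ k) s i.
Proof.
rewrite /other_cycles; apply: eq_big => [x|x /and3P[_ _ xo]]; last first.
  by rewrite insert_cyc_prod.
have [xo|xo] := boolP (x \in porbit t i); last first.
  move: (xo); rewrite insert_porbit in_setU1 negb_or in_setD1 => /andP[-> ->].
  by rewrite /cyc_min insert_porbit_out.
move: xo; rewrite insert_porbit in_setU1 in_setD1.
by case: eqP => //= _; [|move=> ->]; rewrite !andbF.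
Qed.

End RemoveLast.

(** Right multiplication by [tperm i k] turns the permutations with [s k = i] into those fixing [k];
    it supplies the minus sign, and the path loses its last vertex. *)
Lemma padj_last_step T i k : i \in T -> k \in T -> k != i ->
  padj T i k = - \sum_(j in T :\ k) padj (T :\ k) i j * G j k.
Proof.
move=> iT kT ki; rewrite /padj.
rewrite (reindex_inj (mulIg (tperm i k))) /=.
rewrite (eq_bigl (fun s => perm_on (T :\ k) s)); last first.
  move=> s; rewrite permM; apply/andP/idP => [[sT /eqP h]|sT].
    have sk : s k = k by apply: (@perm_inj _ (tperm i k)); rewrite h tpermR.
    apply/subsetP => x; rewrite !inE => sx.
    rewrite (_ : x != k) /=; last by apply: contra_neq sx => ->.
    apply/negPn/negP => xT; case/eqP: sx.
    have := out_perm sT xT; rewrite permM.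
    by case: tpermP => // h2 h3; rewrite ?h2 -?h3 ?iT ?kT // in xT *;
      rewrite -h3 ?iT ?kT in xT.
  have sk : s k = k by apply: (out_perm sT); rewrite !inE eqxx.
  rewrite sk tpermR eqxx; split => //.
  apply/subsetP => x; rewrite !inE permM; apply: contraR => xT.
  have -> : s x = x by apply: (out_perm sT); rewrite !inE (negPf xT) andbF.
  by rewrite tpermD //; apply: contraNneq xT => <-.
(* On the right, the end [j] of the shortened path is determined by [s], as the preimage of [i]. *)
under [X in _ = - X]eq_bigr => j _ do rewrite big_distrl /=.
rewrite (exchange_big_dep (fun s => perm_on (T :\ k) s)) /=; last first.
  by move=> j s _ /andP[].
rewrite -sumrN; apply: eq_bigr => s sT.
have sk : s k = k by apply: (out_perm sT); rewrite !inE eqxx.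
rewrite (big_pred1 ((s^-1)%g i)) => [|j /=].
  rewrite insert_pathprod // insert_other_cycles // odd_permM odd_tperm eq_sym ki.
  by rewrite signr_addb expr1 mulrN1 mulNr !mulrA.
rewrite sT /=; apply/andP/eqP => [[_ /eqP <-]|->]; first by rewrite permK.
rewrite permKV; split => //.
by rewrite -(perm_closed _ sT) permKV !inE eq_sym ki.
Qed.

Lemma padj_sum T i (v : 'I_n -> quat R) : i \in T ->
  \sum_(k in T) padj T i k * v k =
  \sum_(s | perm_on T s)
    (-1) ^+ s * (other_cycles T s i * (pathprod s i * v ((s^-1)%g i))).
Proof.
move=> iT; under eq_bigr => j _ do rewrite big_distrl /=.
rewrite (exchange_big_dep (fun s => perm_on T s)) /=; last by move=> j s _ /andP[].
apply: eq_bigr => s sT; rewrite (big_pred1 ((s^-1)%g i)) => [|j /=].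
  by rewrite !mulrA.
rewrite sT /=; apply/andP/eqP => [[_ /eqP <-]|->]; first by rewrite permK.
by rewrite permKV -(perm_closed _ sT) permKV.
Qed.

End CyclePaths.

Lemma filter_enum_ord_min n (P : pred 'I_n) (m : 'I_n) :
  P m -> (forall x, P x -> (m <= x)%N) ->
  filter P (enum 'I_n) = m :: filter (fun x => P x && (x != m)) (enum 'I_n).
Proof.
move=> Pm minm; pose lt_ord := relpre (val : 'I_n -> nat) ltn.
have lt_tr : transitive lt_ord by move=> y x z; apply: ltn_trans.
have lt_irr : irreflexive lt_ord by move=> x; apply: ltnn.
have so : sorted lt_ord (enum 'I_n).
  by rewrite /lt_ord -sorted_map val_enum_ord iota_ltn_sorted.
apply: (irr_sorted_eq lt_tr lt_irr); first exact: sorted_filter.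
  rewrite /= path_sortedE // sorted_filter // andbT.
  apply/allP => x; rewrite mem_filter => /andP[/andP[Px xm] _].
  by rewrite /lt_ord /= ltn_neqAle minm // andbT eq_sym.
move=> x; rewrite in_cons (mem_filter P) (mem_filter (fun y => P y && _)).
rewrite mem_enum /= !andbT.
by case: eqP => [->|_]; rewrite ?Pm ?andbT.
Qed.

(** The factors need not commute; in decreasing order the one of the least index stands last. *)
Lemma prod_rev_enum_min (R : nzRingType) n (P : pred 'I_n) (m : 'I_n) (F : 'I_n -> R) :
  P m -> (forall x, P x -> (m <= x)%N) ->
  \prod_(x <- rev (enum 'I_n) | P x) F x =
  \prod_(x <- rev (enum 'I_n) | P x && (x != m)) F x * F m.
Proof.
move=> Pm minm; rewrite -big_filter filter_rev (filter_enum_ord_min Pm) //.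
by rewrite rev_cons -cats1 big_cat big_seq1 -filter_rev big_filter.
Qed.

(** * Determinants from real parts of cycle products *)

Section Moore.
Variables (R : rcfType) (n : nat) (G : 'M[quat R]_n).
Implicit Types (T : {set 'I_n}) (s : 'S_n) (i j k x : 'I_n).
Local Notation H := (quat R).

Lemma porbit_sub_on T s i : perm_on T s -> i \in T -> porbit s i \subset T.
Proof.
move=> sT iT; apply/subsetP => x /porbitP[m ->]; rewrite permX.
by elim: m => // m IH; rewrite iterS (perm_closed _ sT).
Qed.

Lemma cyc_prod_pathprod s i : cyc_prod G s i = pathprod G s i * G ((s^-1)%g i) i.
Proof. exact: cyc_prod_path. Qed.

(** Moving the start of a cycle rotates its product, and the real part is invariant under
    rotation. *)
Lemma qre_cyc_prod_step s x : qre (cyc_prod G s (s x)) = qre (cyc_prod G s x).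
Proof.
have ox : porbit s (s x) = porbit s x.
  by apply/eqP; rewrite eq_porbit_mem; have := mem_porbit s 1 x; rewrite expg1.
rewrite /cyc_prod ox.
have hc := iter_perm_card_porbit s x.
have: (0 < #|porbit s x|)%N by apply/card_gt0P; exists x; apply: porbit_id.
case: #|_| hc => // m hc _; rewrite [in LHS]big_ord_recr.
rewrite [in RHS]big_ord_recl [in LHS]qreMC; congr (qre (_ * _)).
  by rewrite -!permM -!expgS hc expg0 perm1 expg1 expgSr permM hc.
by apply: eq_bigr => c _; rewrite -!permM -!expgS.
Qed.

Lemma qre_cyc_prod_porbit s x y :
  y \in porbit s x -> qre (cyc_prod G s y) = qre (cyc_prod G s x).
Proof.
case/porbitP => m ->; rewrite permX; elim: m => // m IH.
by rewrite iterS qre_cyc_prod_step.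
Qed.

Definition repart (x : H) : H := qreal (qre x).
(** For Hermitian [G] this is the Moore determinant of the principal submatrix on [T]. *)
Definition mdet T : R := qre (pdet repart G T).
Local Notation a := (padj repart G).

Lemma prod_repart (P : pred 'I_n) s :
  \prod_(x <- rev (enum 'I_n) | P x) repart (cyc_prod G s x) =
  qreal (\prod_(x | P x) qre (cyc_prod G s x)).
Proof.
rewrite /repart -qreal_prod (perm_big (enum 'I_n)) ?perm_rev //=.
by rewrite big_enum_cond.
Qed.

Lemma pdet_repart T :
  pdet repart G T =
  qreal (\sum_(s | perm_on T s)
           (-1) ^+ s * \prod_(x in T | cyc_min s x) qre (cyc_prod G s x)).
Proof.
rewrite qreal_sum; apply: eq_bigr => s _.
by rewrite prod_repart qrealM qreal_sign.
Qed.

Lemma pdet_repartE T : pdet repart G T = qreal (mdet T).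
Proof. by rewrite /mdet pdet_repart. Qed.

Lemma mdetE T :
  mdet T = \sum_(s | perm_on T s)
             (-1) ^+ s * \prod_(x in T | cyc_min s x) qre (cyc_prod G s x).
Proof. by rewrite /mdet pdet_repart. Qed.

Lemma perm_on0_eq (s : 'S_n) : perm_on set0 s = (s == 1%g).
Proof.
apply/idP/eqP => [h|->]; last exact: perm_on1.
by apply/permP => x; rewrite perm1 (out_perm h) // inE.
Qed.

Lemma mdet0 : mdet set0 = 1.
Proof.
rewrite mdetE (big_pred1 1%g) => [|s]; last by rewrite perm_on0_eq.
by rewrite odd_perm1 mul1r big_pred0 // => x; rewrite inE.
Qed.

Lemma pdet_id0 : pdet id G set0 = 1.
Proof.
rewrite /pdet (big_pred1 1%g) => [|s]; last by rewrite perm_on0_eq.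
by rewrite odd_perm1 mul1r big_pred0 // => x; rewrite inE.
Qed.

(* The real part of a cycle product does not depend on where the cycle starts, so
   the expansion may start at any index. *)
Lemma mdet_loop T i : i \in T ->
  mdet T = qre (\sum_(k in T) a T i k * G k i).
Proof.
move=> iT; rewrite padj_sum // qre_sum mdetE; apply: eq_bigr => s sT.
rewrite -cyc_prod_pathprod /other_cycles prod_repart -qreal_sign !qreM_real.
congr (_ * _).
(* The cycle of [i] enters [mdet] through its least element [y]; every other index with [cyc_min]
   lies outside this cycle. *)
have [y yo miny] := @arg_minnP _ i (mem (porbit s i)) val (porbit_id s i).
have oy : porbit s y = porbit s i by apply/eqP; rewrite eq_porbit_mem.
have yT : y \in T by apply: (subsetP (porbit_sub_on sT iT)).
rewrite (bigD1 y) /=; last first.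
  by rewrite yT; apply/forall_inP => z; rewrite oy; apply: miny.
rewrite (qre_cyc_prod_porbit yo) mulrC; congr (_ * _); apply: eq_bigl => x.
rewrite -andbA; congr (_ && _); have [cx|//] := boolP (cyc_min s x).
rewrite /=; congr (~~ _); apply/eqP/idP => [->//|xo].
apply/val_inj/anti_leq; rewrite (miny _ xo) andbT.
apply: (forall_inP cx).
by have /eqP -> : porbit s x == porbit s i by rewrite eq_porbit_mem.
Qed.

(** Ordered cycle products cannot be rotated, so the expansion is taken at the least index [m],
    whose cycle is the last factor. *)
Lemma pdet_id_loop T m : m \in T -> (forall x, x \in T -> (m <= x)%N) ->
  pdet id G T = \sum_(k in T) padj id G T m k * G k m.
Proof.
move=> mT minm; rewrite padj_sum // /pdet; apply: eq_bigr => s sT.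
rewrite -cyc_prod_pathprod (@prod_rev_enum_min _ _ _ m); first last.
- by move=> x /andP[/minm].
- rewrite mT; apply/forall_inP => z zo; apply: minm.
  exact: (subsetP (porbit_sub_on sT mT)).
congr (_ * _); congr (_ * _); apply: eq_bigl => x.
rewrite -andbA; apply: andb_id2l => xT; apply: andb_id2l => cx.
congr (~~ _); apply/eqP/idP => [->|xo]; first exact: porbit_id.
apply/val_inj/anti_leq; rewrite (minm _ xT) andbT.
by apply: (forall_inP cx); rewrite porbit_sym.
Qed.

End Moore.
Arguments repart {R} x.

Lemma hermqE (R : rcfType) n (G : 'M[quat R]_n) i j :
  hermq G -> qconj (G i j) = G j i.
Proof. by move=> hG; rewrite -[in RHS]hG !mxE. Qed.

(** * The adjugate of a Hermitian matrix *)

Section Hermitian.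
Variables (R : rcfType) (n : nat) (G : 'M[quat R]_n).
Hypothesis hG : hermq G.
Implicit Types (T : {set 'I_n}) (i j k l x : 'I_n).
Local Notation a := (padj repart G).

Lemma setD1C (I : finType) (T : {set I}) (i k : I) : T :\ i :\ k = T :\ k :\ i.
Proof. by rewrite !setDDl setUC. Qed.

Lemma madj_diag T i : i \in T -> a T i i = qreal (mdet G (T :\ i)).
Proof. by move=> iT; rewrite padj_diag // pdet_repartE. Qed.

(** Induction on the size of [T]: removing the last vertex and then the first gives the same double
    sum as the opposite order. The end terms agree because [mdet] is real, hence central. *)
Lemma madj_first_step T i k : i \in T -> k \in T -> k != i ->
  a T i k = - \sum_(j in T :\ i) G i j * a (T :\ i) j k.
Proof.
move: {2}_.+1 (ltnSn #|T|) => m; elim: m T i k => // m IH T i k ltT iT kT ki.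
have iTk : i \in T :\ k by rewrite !inE eq_sym ki.
have kTi : k \in T :\ i by rewrite !inE ki.
rewrite padj_last_step // (big_setD1 i iTk) (big_setD1 k kTi) /=.
rewrite !madj_diag // setD1C qrealC; congr (- (_ + _)).
set U := T :\ i :\ k.
transitivity (- \sum_(j in U) \sum_(l in U) G i l * a U l j * G j k).
  rewrite -sumrN; apply: eq_bigr => j jU; rewrite IH //.
  - by rewrite mulNr big_distrl /= -setD1C.
  - by rewrite (cardsD1 k T) kT in ltT.
  - by move: jU; rewrite !inE => /and3P[-> _ ->].
  - by move: jU; rewrite !inE => /and3P[].
rewrite exchange_big -sumrN; apply: eq_bigr => l lU.
rewrite padj_last_step //; first by rewrite mulrN big_distrr /=;
  congr (- _); apply: eq_bigr => j _; rewrite mulrA.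
  by move: lU; rewrite !inE => /and3P[_ -> ->].
by move: lU; rewrite !inE eq_sym => /and3P[].
Qed.

(** For Hermitian [G], conjugation exchanges the recursions at the two ends of a path. *)
Lemma qconj_madj T i k : i \in T -> k \in T -> qconj (a T i k) = a T k i.
Proof.
move: {2}_.+1 (ltnSn #|T|) => m; elim: m T i k => // m IH T i k ltT iT kT.
have [<-|ki] := eqVneq k i; first by rewrite madj_diag // qconj_real.
rewrite padj_last_step // madj_first_step 1?eq_sym // qconjN qconj_sum.
congr (- _); apply: eq_bigr => j jT; rewrite qconjM hermqE // IH //.
  by rewrite (cardsD1 k T) kT in ltT.
by rewrite !inE eq_sym ki.
Qed.

(** In this form conjugation merely swaps [j] and [l] in the double sum, which will show that the
    sum is real. *)
Lemma madj_loop T i : i \in T ->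
  \sum_(j in T) a T i j * G j i =
  qreal (mdet G (T :\ i)) * G i i
  - \sum_(j in T :\ i) \sum_(l in T :\ i) G i l * a (T :\ i) l j * G j i.
Proof.
move=> iT; rewrite (big_setD1 i iT) /= madj_diag //; congr (_ + _).
rewrite -sumrN; apply: eq_bigr => j; rewrite !inE => /andP[ji jT].
by rewrite madj_first_step // mulNr big_distrl.
Qed.

Lemma madj_mul T i l : i \in T -> l \in T ->
  \sum_(j in T) a T i j * G j l = if i == l then qreal (mdet G T) else 0.
Proof.
move: {2}_.+1 (ltnSn #|T|) => m; elim: m T i l => // m IH T i l ltT iT lT.
have [<-{l lT}|il] := eqVneq i l.
  (* On the diagonal it suffices that the sum is self-conjugate: its real part is [mdet G T]. *)
  rewrite (mdet_loop G iT) -qconj_fixed // madj_loop //.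
  rewrite qconjD qconjN qconjM qconj_real hermqE // -qrealC; congr (_ - _).
  rewrite qconj_sum exchange_big; apply: eq_bigr => j jT.
  rewrite qconj_sum; apply: eq_bigr => h hT.
  by rewrite !qconjM !hermqE // qconj_madj // mulrA.
(* Off the diagonal, the first-step recursion and induction on [T :\ i] leave two copies of
   [mdet G (T :\ i)] times [G i l], which cancel. *)
rewrite (big_setD1 i iT) /= madj_diag //.
have lTi : l \in T :\ i by rewrite !inE eq_sym il.
transitivity (qreal (mdet G (T :\ i)) * G i l -
   \sum_(h in T :\ i) G i h * (if h == l then qreal (mdet G (T :\ i)) else 0)).
  congr (_ + _); transitivity
    (- \sum_(j in T :\ i) \sum_(h in T :\ i) G i h * a (T :\ i) h j * G j l).
    rewrite -sumrN; apply: eq_bigr => j; rewrite !inE => /andP[ji jT].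
    by rewrite madj_first_step // mulNr big_distrl.
  rewrite exchange_big; congr (- _); apply: eq_bigr => h hT.
  rewrite -IH //; first by rewrite big_distrr /=; apply: eq_bigr => j _; rewrite mulrA.
  by rewrite (cardsD1 i T) iT in ltT.
rewrite (big_setD1 l lTi) /= eqxx big1 ?addr0 -?qrealC ?subrr // => h.
by rewrite !inE => /andP[/negPf-> _]; rewrite mulr0.
Qed.

(** Joint induction: both weights obey the last-step recursion, with smaller determinants as
    diagonal values, and expansion at the least index then identifies the determinants through
    [madj_mul]. *)
Lemma pdet_padj_id T :
  pdet id G T = qreal (mdet G T) /\
  forall i k, i \in T -> k \in T -> padj id G T i k = a T i k.
Proof.
move: {2}_.+1 (ltnSn #|T|) => m; elim: m T => // m IH T ltT.
have P i k : i \in T -> k \in T -> padj id G T i k = a T i k.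
  move=> iT kT; have [<-|ki] := eqVneq k i.
    rewrite padj_diag // madj_diag //; apply: (IH _ _).1.
    by rewrite (cardsD1 k T) kT in ltT.
  rewrite !padj_last_step //; congr (- _); apply: eq_bigr => j jT.
  rewrite (IH _ _).2 //; first by rewrite (cardsD1 k T) kT in ltT.
  by rewrite !inE eq_sym ki.
split => //; have [->|[y yT]] := set_0Vmem T; first by rewrite pdet_id0 mdet0.
have [i iT mini] := @arg_minnP _ y (mem T) val yT.
rewrite (@pdet_id_loop _ _ _ _ i) //.
transitivity (\sum_(k in T) a T i k * G k i).
  by apply: eq_bigr => k kT; rewrite P.
by rewrite madj_mul // eqxx.
Qed.

Lemma cdetq_colrep i (v : 'cV[quat R]_n) :
  cdetq i (colrep G i v) = \sum_k a setT i k * v k ord0.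
Proof.
transitivity (\sum_(k in setT) padj id G setT i k * v k ord0); last first.
  apply: eq_big => k; first by rewrite inE.
  by move=> _; rewrite (pdet_padj_id setT).2 ?inE.
rewrite (@padj_sum _ _ _ _ _ _ (fun k => v k ord0)) ?inE // /cdetq.
rewrite [RHS](eq_bigl predT); last by move=> s; apply/subsetP => x; rewrite inE.
apply: eq_bigr => s _; congr (_ * (_ * _)).
(* The bound makes the truncated [n - #|porbits s|] a true difference, whose parity is that of
   [s]. *)
- have le_on : (#|porbits s| <= n)%N.
    by rewrite -[X in (_ <= X)%N]card_ord /porbits leq_imset_card.
  by rewrite -signr_odd oddB // /odd_perm card_ord.
- rewrite /other_cycles; apply: eq_big => x; first by rewrite inE.
  move=> /andP[_ xo]; apply: eq_bigr => m _; rewrite mxE ifN //.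
  apply: contraNneq xo => <-; rewrite porbit_sym; exact: mem_porbit.
rewrite (@cyc_prod_path _ _ G) ?mxE ?eqxx // => r c /negPf ci.
by rewrite mxE ci.
Qed.

End Hermitian.

(** * Row determinants and principal minors *)

Section Adjoint.
Variable R : rcfType.
Local Notation H := (quat R).

Lemma adjqE m n (C : 'M[H]_(m, n)) i j : adjq C i j = qconj (C j i).
Proof. by rewrite !mxE. Qed.

Lemma adjqK m n (C : 'M[H]_(m, n)) : adjq (adjq C) = C.
Proof. by apply/matrixP => i j; rewrite !adjqE qconjK. Qed.

Lemma adjqM m n p (C : 'M[H]_(m, n)) (D : 'M[H]_(n, p)) :
  adjq (C *m D) = adjq D *m adjq C.
Proof.
apply/matrixP => i j; rewrite adjqE !mxE qconj_sum; apply: eq_bigr => k _.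
by rewrite qconjM !adjqE.
Qed.

Lemma adjqD m n (C D : 'M[H]_(m, n)) : adjq (C + D) = adjq C + adjq D.
Proof. by apply/matrixP => i j; rewrite adjqE !mxE qconjD. Qed.

Lemma adjqN m n (C : 'M[H]_(m, n)) : adjq (- C) = - adjq C.
Proof. by apply/matrixP => i j; rewrite adjqE !mxE qconjN. Qed.

Lemma adjq0 m n : adjq (0 : 'M[H]_(m, n)) = 0.
Proof. by apply/matrixP => i j; rewrite adjqE !mxE qconj0. Qed.

Lemma adjq_real n (a : R) : adjq ((qreal a)%:M : 'M[H]_n) = (qreal a)%:M.
Proof.
apply/matrixP => i j; rewrite adjqE !mxE eq_sym.
by case: eqP => _; rewrite ?mulr1n ?mulr0n ?qconj_real ?qconj0.
Qed.

Lemma adjq1 n : adjq (1%:M : 'M[H]_n) = 1%:M.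
Proof. exact: (adjq_real n 1). Qed.

Lemma qreal_mxC m n (a : R) (C : 'M[H]_(m, n)) :
  C *m (qreal a)%:M = (qreal a)%:M *m C.
Proof.
rewrite mul_scalar_mx; apply/matrixP => i j; rewrite !mxE (bigD1 j) //= !mxE eqxx.
rewrite big1 ?addr0 -?qrealC ?mulr1n // => k /negPf kj.
by rewrite mxE kj mulr0n mulr0.
Qed.

Lemma qconj_prod_rev (I : Type) (r : seq I) (P : pred I) (F : I -> H) :
  qconj (\prod_(x <- rev r | P x) F x) = \prod_(x <- r | P x) qconj (F x).
Proof.
elim: r => [|x r IH]; first by rewrite !big_nil qconj1.
rewrite rev_cons -cats1 big_cat qconjM IH !big_cons big_nil.
by case: (P x); rewrite /= ?mulr1 // qconj1 mul1r.
Qed.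

Lemma qconj_prod_ord m (F : nat -> H) :
  qconj (\prod_(k < m) F k) = \prod_(k < m) qconj (F (m - k.+1)%N).
Proof.
elim: m F => [|m IH] F; first by rewrite !big_ord0 qconj1.
by rewrite big_ord_recr qconjM IH [in RHS]big_ord_recl subn1.
Qed.

(** Conjugation reverses the product and [adjq] swaps the indices of each factor, so the cycle is
    read backwards. *)
Lemma qconj_cyc_prod n (C : 'M[H]_n) (s : 'S_n) x :
  qconj (cyc_prod (adjq C) s x) = cyc_prod C s^-1 x.
Proof.
rewrite /cyc_prod porbitV.
rewrite (qconj_prod_ord _ (fun k => adjq C ((s ^+ k)%g x) ((s ^+ k.+1)%g x))).
apply: eq_bigr => k _; rewrite adjqE qconjK.
have expV c : (c <= #|porbit s x|)%N ->
    (s ^+ (#|porbit s x| - c))%g x = (s^-1 ^+ c)%g x.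
  move=> cm; apply: (@perm_inj _ (s ^+ c)%g).
  by rewrite -!permM -expgD subnK // iter_perm_card_porbit expgVn mulVg perm1.
by rewrite -subSn // subSS !expV // ltnW.
Qed.

(** Passing to [s^-1] keeps the orbits, hence the signs and the least elements, while conjugation
    turns the decreasing order with the cycle of [i] last into the increasing order with it
    first. *)
Lemma rdetq_cdetq n (C : 'M[H]_n) i : rdetq i C = qconj (cdetq i (adjq C)).
Proof.
rewrite /rdetq /cdetq qconj_sum (reindex_inj invg_inj) /=.
apply: eq_bigr => s _; rewrite qconjM qconjM qconj_prod_rev qconj_cyc_prod.
have -> : #|porbits s^-1| = #|porbits s|.
  by congr #|pred_of_set _|; apply: eq_imset => x; rewrite porbitV.
have -> : qconj ((-1) ^+ (n - #|porbits s|)) = (-1) ^+ (n - #|porbits s|) :> H.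
  by rewrite -signr_odd -qreal_sign qconj_real.
rewrite -commr_sign; congr (_ * _); congr (_ * _); apply: eq_big => x.
  rewrite porbitV; congr (_ && _).
  by apply: eq_forallb => y; rewrite porbitV.
by move=> _; rewrite qconj_cyc_prod.
Qed.

Lemma adjq_rowrep n (C : 'M[H]_n) j (w : 'rV[H]_n) :
  adjq (rowrep C j w) = colrep (adjq C) j (adjq w).
Proof.
apply/matrixP => r c; rewrite adjqE !mxE.
by case: (c == j); rewrite ?mxE.
Qed.

Lemma adjq_subq n (C : 'M[H]_n) b : adjq (Defs.subq C b) = Defs.subq (adjq C) b.
Proof. by apply/matrixP => r c; rewrite adjqE !mxE. Qed.

Lemma rdet_cdet_subq n (C : 'M[H]_n) b j :
  rdet_subq C b j = qconj (cdet_subq (adjq C) b j).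
Proof.
rewrite /rdet_subq /cdet_subq; case: insub => [i|]; last by rewrite qconj0.
by rewrite rdetq_cdetq adjq_subq.
Qed.

End Adjoint.

(** * Injective reindexing *)

Section Submatrix.
Variables (R : rcfType) (n m : nat) (f : 'I_m -> 'I_n).
Hypothesis f_inj : injective f.
Variable G : 'M[quat R]_n.

Lemma imset_setD1 (T : {set 'I_m}) k : f @: (T :\ k) = (f @: T) :\ f k.
Proof.
apply/setP => x; rewrite !inE; apply/imsetP/andP => [[y]|[xk /imsetP[y yT xE]]].
  by rewrite !inE => /andP[yk yT] ->; rewrite (inj_eq f_inj) yk imset_f.
by exists y => //; rewrite !inE yT andbT; apply: contra_neq xk => <-.
Qed.

(** The recursions refer to membership and not, as [cyc_min] does, to the order of the indices, so
    an induction through them carries both quantities along an injection. *)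
Lemma moore_mxsub (T : {set 'I_m}) :
  mdet (mxsub f f G) T = mdet G (f @: T) /\
  forall u v, u \in T -> v \in T ->
    padj repart (mxsub f f G) T u v = padj repart G (f @: T) (f u) (f v).
Proof.
move: {2}_.+1 (ltnSn #|T|) => c; elim: c T => // c IH T ltT.
have P u v : u \in T -> v \in T ->
    padj repart (mxsub f f G) T u v = padj repart G (f @: T) (f u) (f v).
  move=> uT vT; have ltv : (#|T :\ v| < c)%N by rewrite (cardsD1 v T) vT in ltT.
  have [<-|vu] := eqVneq v u.
    by rewrite !madj_diag ?imset_f // -imset_setD1 (IH _ ltv).1.
  rewrite !padj_last_step ?imset_f ?(inj_eq f_inj) //; congr (- _).
  rewrite -imset_setD1 big_imset; last by move=> x y _ _; apply: f_inj.
  apply: eq_bigr => j jT; rewrite (IH _ ltv).2 ?mxE //.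
  by rewrite !inE eq_sym vu.
split=> //; have [->|[y yT]] := set_0Vmem T; first by rewrite imset0 !mdet0.
rewrite (mdet_loop _ yT) (mdet_loop _ (imset_f f yT)); congr (qre _).
rewrite big_imset; last by move=> x z _ _; apply: f_inj.
by apply: eq_bigr => j jT; rewrite P // mxE.
Qed.

End Submatrix.

Lemma hdetq_mdet (R : rcfType) n (G : 'M[quat R]_n) :
  hermq G -> hdetq G = mdet G setT.
Proof.
case: n G => [|n] G hG /=.
  by rewrite (_ : setT = set0) ?mdet0 //; apply/setP => -[].
rewrite rdetq_cdetq hG qre_conj (mdet_loop _ (in_setT ord0)).
(* Replacing a column of [G] by itself makes [cdetq_colrep] applicable. *)
rewrite -[in cdetq _ _](_ : colrep G ord0 (col ord0 G) = G); last first.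
  by apply/matrixP => r c; rewrite !mxE; case: eqP => [->|].
rewrite cdetq_colrep //; congr (qre _).
by apply: eq_big => k; rewrite ?inE // mxE.
Qed.

(** * Sums of principal minors and the Faddeev-LeVerrier recursion *)

Section PrincipalMinors.
Variables (R : rcfType) (n : nat) (G : 'M[quat R]_n).
Hypothesis hG : hermq G.
Implicit Types (b : {set 'I_n}) (i j k l x : 'I_n).
Local Notation a := (padj repart G).

Lemma enum_val_imsetT b : (enum_val : 'I_#|b| -> _) @: setT = b.
Proof.
apply/setP => x; apply/imsetP/idP => [[u _ ->]|xb]; first exact: enum_valP.
by exists (enum_rank_in xb x); rewrite ?enum_rankK_in.
Qed.

Lemma hermq_subq b : hermq (Defs.subq G b).
Proof. by rewrite /hermq adjq_subq hG. Qed.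

Lemma cdet_subq_colrep b i (v : 'cV[quat R]_n) : i \in b ->
  cdet_subq (colrep G i v) b i = \sum_(k in b) a b i k * v k ord0.
Proof.
move=> ib; rewrite /cdet_subq.
have lti : (index i (enum b) < #|b|)%N by rewrite cardE index_mem mem_enum.
(* As [i] is in [b], the default value 0 of [cdet_subq] does not arise. *)
rewrite insubT; set u := Sub _ _.
have fu : enum_val u = i.
  by rewrite (enum_val_nth i) /= nth_index // mem_enum.
have -> : Defs.subq (colrep G i v) b =
          colrep (Defs.subq G b) u (\col_w v (enum_val w) ord0).
  apply/matrixP => r c; rewrite !mxE -fu (inj_eq enum_val_inj).
  by case: eqP.
rewrite cdetq_colrep; last exact: hermq_subq.
rewrite [RHS]big_enum_val; apply: eq_bigr => k _; rewrite mxE.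
by rewrite (moore_mxsub (@enum_val_inj _ _) G setT).2 ?inE // enum_val_imsetT fu.
Qed.

Lemma hdetq_subq b : hdetq (Defs.subq G b) = mdet G b.
Proof.
rewrite hdetq_mdet; last exact: hermq_subq.
by rewrite (moore_mxsub (@enum_val_inj _ _) G setT).1 enum_val_imsetT.
Qed.

(** The adjugates on the sets of size [r], extended by zero and added up. *)
Definition minors_adj r : 'M[quat R]_n :=
  \matrix_(i, j) \sum_(b : {set 'I_n} | [&& #|b| == r, i \in b & j \in b]) a b i j.
Local Notation L := minors_adj.

Lemma sum_cdet_subq r i (v : 'cV[quat R]_n) :
  \sum_(b : {set 'I_n} | (#|b| == r) && (i \in b)) cdet_subq (colrep G i v) b i =
  (L r *m v) i ord0.
Proof.
rewrite mxE; under [RHS]eq_bigr => j _ do rewrite mxE big_distrl /=.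
rewrite (exchange_big_dep (fun b => (#|b| == r) && (i \in b))) /=; last first.
  by move=> j b _ /and3P[-> ->].
apply: eq_bigr => b /andP[-> ib]; rewrite cdet_subq_colrep //.
by apply: eq_bigl => j; rewrite ib.
Qed.

Lemma minors_adj_mul r (C : 'M[quat R]_n) i l :
  (L r *m C) i l =
  \sum_(b : {set 'I_n} | (#|b| == r) && (i \in b)) \sum_(j in b) a b i j * C j l.
Proof.
rewrite mxE; under [LHS]eq_bigr => j _ do rewrite mxE big_distrl /=.
rewrite (exchange_big_dep (fun b => (#|b| == r) && (i \in b))) /=; last first.
  by move=> j b _ /and3P[-> ->].
apply: eq_bigr => b /andP[-> ib].
by apply: eq_bigl => j; rewrite ib.
Qed.

Lemma sum_sets_setD1 (V : nmodType) r l (Q : pred {set 'I_n}) (F : {set 'I_n} -> V) :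
  \sum_(c : {set 'I_n} | [&& #|c| == r.+1, l \in c & Q (c :\ l)]) F (c :\ l) =
  \sum_(b : {set 'I_n} | [&& #|b| == r, l \notin b & Q b]) F b.
Proof.
rewrite (reindex_onto (fun b => l |: b) (fun c => c :\ l)) /=; last first.
  by move=> c /and3P[_ lc _]; rewrite setD1K.
apply: eq_big => [b|b /andP[_ /eqP->]//].
rewrite setU11 cardsU1; have [lb|lb] /= := boolP (l \in b).
  rewrite andbF; apply/negP => /andP[_ /eqP h].
  by move: lb; rewrite -h !inE eqxx.
by rewrite setU1K // eqxx andbT add1n eqSS.
Qed.

Lemma minors_adj_mulG_diag r i :
  (L r *m G) i i = qreal (\sum_(b : {set 'I_n} | (#|b| == r) && (i \in b)) mdet G b).
Proof.
rewrite minors_adj_mul qreal_sum; apply: eq_bigr => b /andP[_ ib].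
by rewrite madj_mul // eqxx.
Qed.

Lemma sum_pminors_mdet r :
  sum_pminors G r = \sum_(b : {set 'I_n} | #|b| == r) mdet G b.
Proof. by apply: eq_bigr => b _; rewrite hdetq_subq. Qed.

(** On the diagonal, the minors on sets containing [i] come from [L r *m G] and the others from
    [L r.+1]. Off it, the sets containing [l] contribute zero by [madj_mul], and those missing [l]
    cancel by [padj_last_step]. *)
Lemma minors_adj_rec r : L r.+1 + L r *m G = (qreal (sum_pminors G r))%:M.
Proof.
apply/matrixP => i l; rewrite [LHS]mxE [RHS]mxE.
have [<-{l}|il] := eqVneq i l.
  rewrite minors_adj_mulG_diag mulr1n sum_pminors_mdet [in RHS](bigID (fun b => i \in b)).
  rewrite [LHS]addrC qrealD; congr (_ + _); rewrite mxE qreal_sum.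
  transitivity (\sum_(c : {set 'I_n} | [&& #|c| == r.+1, i \in c & predT (c :\ i)])
     qreal (mdet G (c :\ i))).
    apply: eq_big => [c|c /and3P[_ ic _]]; last by rewrite madj_diag.
    by rewrite andbb andbT.
  rewrite (@sum_sets_setD1 _ r i predT (fun c => qreal (mdet G c))).
  by apply: eq_bigl => b; rewrite andbT.
rewrite mulr0n minors_adj_mul [in X in _ + X](bigID (fun b => l \in b)) /=.
rewrite [X in _ + (X + _)]big1 => [|b /andP[/andP[_ ib] lb]]; last first.
  by rewrite madj_mul // (negPf il).
rewrite add0r mxE.
transitivity (\sum_(c : {set 'I_n} | [&& #|c| == r.+1, l \in c & i \in c :\ l])
     (- \sum_(j in c :\ l) a (c :\ l) i j * G j l) +
  \sum_(b : {set 'I_n} | (#|b| == r) && (i \in b) && (l \notin b))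
     \sum_(j in b) a b i j * G j l).
  congr (_ + _); apply: eq_big => [c|c /and3P[_ ic lc]].
    by rewrite in_setD1 il [(i \in c) && _]andbC.
  by rewrite padj_last_step // eq_sym.
rewrite (@sum_sets_setD1 _ r l (fun c => i \in c)
  (fun c => - \sum_(j in c) a c i j * G j l)).
rewrite sumrN [X in - X + _](eq_bigl
  (fun b : {set 'I_n} => (#|b| == r) && (i \in b) && (l \notin b))) ?addNr //.
by move=> b; rewrite -andbA [(i \in b) && _]andbC.
Qed.

Lemma hermq_minors_adj r : hermq (L r).
Proof.
apply/matrixP => i j; rewrite adjqE !mxE qconj_sum; apply: eq_big => [b|b].
  by congr (_ && _); rewrite andbC.
by move=> /and3P[_ ? ?]; rewrite qconj_madj.
Qed.

(** The adjoint of the recursion differs from it only in the order of this product. *)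
Lemma minors_adjC r : L r *m G = G *m L r.
Proof.
have h := minors_adj_rec r; have := congr1 (@adjq R n n) h.
rewrite adjqD adjqM adjq_real hG !hermq_minors_adj -h => /addrI.
by move=> ->.
Qed.

Lemma minors_adj_large r : (n < r)%N -> L r = 0.
Proof.
move=> ltnr; apply/matrixP => i j; rewrite !mxE big_pred0 // => b.
apply/negP => /and3P[/eqP br _ _].
by have := max_card (mem b); rewrite br card_ord leqNgt ltnr.
Qed.

Lemma sum_pminors0 : sum_pminors G 0 = 1.
Proof.
rewrite sum_pminors_mdet (big_pred1 set0) ?mdet0 // => b.
by rewrite cards_eq0.
Qed.

Lemma sum_pminors_large r : (n < r)%N -> sum_pminors G r = 0.
Proof.
move=> ltnr; rewrite sum_pminors_mdet big_pred0 // => b; apply/negP => /eqP br.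
by have := max_card (mem b); rewrite br card_ord leqNgt ltnr.
Qed.

(** Each set of size [r] is counted once for each of its elements. *)
Lemma trace_minors_adjM r :
  \sum_i qre ((L r *m G) i i) = r%:R * sum_pminors G r.
Proof.
rewrite sum_pminors_mdet big_distrr /=.
under eq_bigr => i _ do rewrite minors_adj_mulG_diag /=.
rewrite (exchange_big_dep (fun b => #|b| == r)) /=; last by move=> i b _ /andP[].
apply: eq_bigr => b /eqP br; rewrite br eqxx /= -br -sum1_card natr_sum big_distrl /=.
by apply: eq_bigr => i _; rewrite mul1r.
Qed.

Lemma cdetq_full i (v : 'cV[quat R]_n) : cdetq i (colrep G i v) = (L n *m v) i ord0.
Proof.
rewrite cdetq_colrep // mxE; apply: eq_bigr => k _; rewrite mxE.
rewrite (big_pred1 setT) // => b; apply/and3P/eqP => [[/eqP bn _ _]|->].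
  by apply/eqP; rewrite eqEcard subsetT cardsT card_ord bn leqnn.
by rewrite cardsT card_ord eqxx !inE.
Qed.

Lemma hdetq_full : hdetq G = sum_pminors G n.
Proof.
rewrite (hdetq_mdet hG) sum_pminors_mdet (big_pred1 setT) // => b.
apply/eqP/eqP => [bn|->]; last by rewrite cardsT card_ord.
by apply/eqP; rewrite eqEcard subsetT cardsT card_ord bn leqnn.
Qed.

Lemma sum_rdet_subq r j (w : 'rV[quat R]_n) :
  \sum_(b : {set 'I_n} | (#|b| == r) && (j \in b)) rdet_subq (rowrep G j w) b j =
  (w *m L r) ord0 j.
Proof.
under eq_bigr => b _ do rewrite rdet_cdet_subq adjq_rowrep hG.
by rewrite -qconj_sum sum_cdet_subq -adjqE adjqM adjqK hermq_minors_adj.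
Qed.

Lemma rdetq_full j (w : 'rV[quat R]_n) : rdetq j (rowrep G j w) = (w *m L n) ord0 j.
Proof.
rewrite rdetq_cdetq adjq_rowrep hG cdetq_full -adjqE adjqM adjqK.
by rewrite hermq_minors_adj.
Qed.

End PrincipalMinors.

(** * Rank and principal minors *)

Section Definiteness.
Variable R : rcfType.
Local Notation H := (quat R).

Lemma qmul_eq0_r (x y : H) : x != 0 -> x * y = 0 -> y = 0.
Proof.
move=> x0 xy0; have cx : qconj x * x = qreal (qre (qconj x * x)).
  by apply: qconj_fixed; rewrite qconjM qconjK.
have nz : qre (qconj x * x) != 0.
  apply: contra_neq x0 => h; apply: qnorm_eq0; by rewrite qreMC.
rewrite -[y]mul1r -[1]/(qreal 1) -(mulVf nz) qrealM -cx -!mulrA xy0.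
by rewrite !mulr0.
Qed.

Lemma mulmx_adjq_eq0 m n (X : 'M[H]_(m, n)) : X *m adjq X = 0 -> X = 0.
Proof.
move=> X0; apply/matrixP => i j; rewrite mxE; apply: qnorm_eq0; move: j.
have := congr1 (fun Y : 'M[H]_m => qre (Y i i)) X0; rewrite !mxE qre_sum.
move=> /eqP; rewrite psumr_eq0 => [/allP h j|k _]; last by rewrite adjqE qnorm_ge0.
by have := h j (mem_index_enum j); rewrite adjqE => /eqP.
Qed.

Lemma adjq_mulmx_eq0 m n (X : 'M[H]_(m, n)) : adjq X *m X = 0 -> X = 0.
Proof.
by move=> X0; rewrite -[X]adjqK [adjq X]mulmx_adjq_eq0 ?adjq0 // adjqK.
Qed.

(** The diagonal entries of [X^* C X] are the values of the form at the columns of [X]. *)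
Lemma posdefq_eq0 n p (C : 'M[H]_n) (X : 'M[H]_(n, p)) :
  posdefq C -> adjq X *m C *m X = 0 -> X = 0.
Proof.
case=> _ pC X0; apply/matrixP => i j; rewrite mxE.
have [h|/pC] := eqVneq (col j X) 0.
  by have := congr1 (fun Y : 'cV[H]_n => Y i ord0) h; rewrite !mxE.
have -> : (adjq (col j X) *m C *m col j X) ord0 ord0 = (adjq X *m C *m X) j j.
  rewrite !mxE; apply: eq_bigr => k _; rewrite !mxE; congr (_ * _).
  by apply: eq_bigr => l _; rewrite !mxE.
by rewrite X0 mxE => -[_ _ _]; rewrite ltxx.
Qed.

Lemma posdefq_inj n p (C : 'M[H]_n) (X : 'M[H]_(n, p)) :
  posdefq C -> C *m X = 0 -> X = 0.
Proof. by move=> pC CX; apply: (posdefq_eq0 pC); rewrite -mulmxA CX mulmx0. Qed.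

(** The real part makes this trace invariant under exchange of factors, which fails for the
    quaternion sum. *)
Definition qtr n (X : 'M[H]_n) : R := \sum_i qre (X i i).

Lemma qtrMC m n (X : 'M[H]_(m, n)) (Y : 'M[H]_(n, m)) :
  qtr (X *m Y) = qtr (Y *m X).
Proof.
rewrite /qtr; under eq_bigr => i _ do rewrite mxE qre_sum.
rewrite exchange_big; apply: eq_bigr => j _; rewrite mxE qre_sum.
by apply: eq_bigr => i _; rewrite qreMC.
Qed.

Lemma qtr1 n : qtr (1%:M : 'M[H]_n) = n%:R.
Proof.
rewrite /qtr; under eq_bigr => i _ do rewrite mxE eqxx mulr1n.
by rewrite /= sumr_const card_ord.
Qed.

Lemma qtrZ n (a : R) (X : 'M[H]_n) : qtr ((qreal a)%:M *m X) = a * qtr X.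
Proof.
rewrite /qtr mulr_sumr; apply: eq_bigr => i _.
by rewrite mul_scalar_mx mxE qreM_real.
Qed.

End Definiteness.

(** * The range projection and its trace *)

Section RankProjection.
Variable R : rcfType.
Local Notation H := (quat R).

Section LargestMinor.
Variables (n : nat) (G : 'M[H]_n) (r : nat).
Hypothesis hG : hermq G.
Hypothesis d_neq0 : sum_pminors G r != 0.
Hypothesis d_eq0 : forall k, (r < k)%N -> sum_pminors G k = 0.
Local Notation L := (minors_adj G).
Local Notation d := (sum_pminors G).

(** Downward induction from orders above [n]. The recursion times [G] gives [L k G G = 0], so the
    product of [L k G] with its adjoint [G L k] vanishes. *)
Lemma minors_adjM_eq0 k : (r < k)%N -> L k *m G = 0.
Proof.
have [c] := ubnP (n.+1 - k); elim: c k => // c IH k lt_c lt_rk.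
have [lt_nk|le_kn] := ltnP n k.
  by rewrite minors_adj_large // mul0mx.
have next0 : L k.+1 *m G = 0.
  by apply: IH; [rewrite -ltnS (leq_trans _ lt_c) // ltnS ltn_sub2l|exact: leqW].
have LGG : L k *m G *m G = 0.
  have := congr1 (mulmx^~ G) (minors_adj_rec hG k).
  by rewrite /= mulmxDl next0 add0r (d_eq0 lt_rk) mul_scalar_mx scale0r.
apply: mulmx_adjq_eq0.
by rewrite adjqM hG (hermq_minors_adj hG) mulmxA LGG mul0mx.
Qed.

Lemma minors_adjMM : L r *m G *m G = (qreal (d r))%:M *m G.
Proof.
by rewrite -(minors_adj_rec hG r) mulmxDl (minors_adjM_eq0 (ltnSn r)) add0r.
Qed.

(** An inner inverse of [G] commuting with [G]; it may be nonzero on the kernel of [G], so in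
    general it is not the Moore-Penrose inverse. *)
Definition herm_inv := (qreal (d r)^-1)%:M *m L r.

Lemma herm_invC : herm_inv *m G = G *m herm_inv.
Proof. by rewrite /herm_inv -mulmxA (minors_adjC hG) !mulmxA qreal_mxC. Qed.

Lemma hermq_herm_inv : hermq herm_inv.
Proof. by rewrite /hermq adjqM adjq_real (hermq_minors_adj hG) qreal_mxC. Qed.

Lemma hermq_herm_invM : hermq (G *m herm_inv).
Proof. by rewrite /hermq adjqM hermq_herm_inv hG herm_invC. Qed.

Lemma herm_invMK : G *m herm_inv *m G = G.
Proof.
rewrite -herm_invC /herm_inv -!mulmxA [L r *m (G *m G)]mulmxA minors_adjMM.
by rewrite mulmxA -scalar_mxM -qrealM (mulVf d_neq0) qreal1 mul1mx.
Qed.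

Lemma qtr_herm_invM : qtr (G *m herm_inv) = r%:R.
Proof.
rewrite -herm_invC /herm_inv -mulmxA qtrZ [qtr _](trace_minors_adjM hG).
by rewrite mulrCA (mulVf d_neq0) mulr1.
Qed.

End LargestMinor.

Lemma largest_pminor n (G : 'M[H]_n) : hermq G ->
  exists2 r, sum_pminors G r != 0 & forall k, (r < k)%N -> sum_pminors G k = 0.
Proof.
move=> hG; have ex : exists r, sum_pminors G r != 0.
  by exists 0%N; rewrite sum_pminors0 // oner_eq0.
have ub r : sum_pminors G r != 0 -> (r <= n)%N.
  by apply: contra_neqT; rewrite -ltnNge; apply: sum_pminors_large.
case: (ex_maxnP ex ub) => r dr maxr; exists r => // k ltrk.
by apply/eqP/negPn/negP => /maxr; rewrite leqNgt ltrk.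
Qed.

Lemma herm_pinv n (G : 'M[H]_n) : hermq G ->
  exists Gi : 'M[H]_n,
    [/\ G *m Gi = Gi *m G, hermq Gi, hermq (G *m Gi) & G *m Gi *m G = G].
Proof.
move=> hG; have [r dr d0] := largest_pminor hG; exists (herm_inv G r); split.
- by rewrite herm_invC.
- exact: hermq_herm_inv.
- exact: hermq_herm_invM.
- exact: herm_invMK.
Qed.

Lemma rindepP m n (C : 'M[H]_(m, n)) (S : {set 'I_n}) :
  rindep C S <->
  forall x : 'cV[H]_n, (forall j, j \notin S -> x j ord0 = 0) -> C *m x = 0 -> x = 0.
Proof.
split=> [iS x xS Cx0|iS c h].
  apply/matrixP => j k; rewrite ord1 mxE; have [jS|/xS//] := boolP (j \in S).
  apply: (iS (fun j => x j ord0)) => // i.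
  transitivity ((C *m x) i ord0); last by rewrite Cx0 mxE.
  rewrite mxE [RHS](bigID (mem S)) /= [X in _ + X]big1 ?addr0 // => l lS.
  by rewrite xS // mulr0.
move=> j jS.
(* The coefficients outside [S] are arbitrary in [rindep], hence the truncation. *)
have /(congr1 (fun Y : 'cV[H]_n => Y j ord0)) :
  \col_k (if k \in S then c k else 0) = 0 :> 'cV[H]_n.
  apply: iS => [k kS|]; first by rewrite mxE (negPf kS).
  apply/matrixP => i k; rewrite [RHS]mxE -[RHS](h i) mxE [RHS]big_mkcond.
  by apply: eq_bigr => l _; rewrite mxE; case: ifP => //; rewrite mulr0.
by rewrite !mxE jS.
Qed.

(** Injectivity of [V] makes the inner inverse [Ki] of the Gram matrix [K] a true inverse; with
    [Y = Ki V^*], [V Y] is the orthogonal projection onto the range of [V]. *)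
Lemma injective_projection n c (V : 'M[H]_(n, c)) :
  (forall x : 'M[H]_c, V *m x = 0 -> x = 0) ->
  exists2 Y : 'M[H]_(c, n), Y *m V = 1%:M & hermq (V *m Y).
Proof.
move=> Vinj; have [K KE] : exists K, K = adjq V *m V by exists (adjq V *m V).
have hK : hermq K by rewrite KE /hermq adjqM adjqK.
have [Ki [KC hKi hE KK]] := herm_pinv hK.
have K1 : K *m Ki = 1%:M.
  have K0 : K *m (1%:M - K *m Ki) = 0 by rewrite mulmxBr mulmx1 KC mulmxA KK subrr.
  apply/eqP; rewrite eq_sym -subr_eq0; apply/eqP/Vinj/adjq_mulmx_eq0.
  by rewrite adjqM -mulmxA [adjq V *m _]mulmxA -KE K0 mulmx0.
exists (Ki *m adjq V); first by rewrite -mulmxA -KE -KC.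
by rewrite /hermq adjqM [adjq (Ki *m _)]adjqM adjqK hKi mulmxA.
Qed.

(** [F] projects orthogonally onto the span of a maximal independent set [S] of columns; its trace
    comes from rotating [V Y] into [Y V = 1]. *)
Lemma column_projection n q (B : 'M[H]_(n, q)) r : qrank_is B r ->
  exists F : 'M[H]_n, exists Z : 'M[H]_(q, n),
    [/\ hermq F, F *m B = B, F = B *m Z & qtr F = r%:R].
Proof.
case=> -[S [iS cS]] maxS.
pose J : 'M[H]_(q, #|S|) := \matrix_(j, u) (j == enum_val u)%:R.
have [V VJ] : exists V, V = B *m J by exists (B *m J).
have JE p (x : 'M[H]_(#|S|, p)) u c : (J *m x) (enum_val u) c = x u c.
  rewrite mxE (bigD1 u) //= mxE eqxx mul1r big1 ?addr0 // => w wu.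
  by rewrite mxE (inj_eq enum_val_inj) eq_sym (negPf wu) mul0r.
have JN (x : 'cV[H]_#|S|) j c : j \notin S -> (J *m x) j c = 0.
  move=> jS; rewrite mxE big1 // => u _; rewrite mxE.
  case: eqP => [h|]; last by rewrite mul0r.
  by move: jS; rewrite h enum_valP.
have VE i u : V i u = B i (enum_val u).
  rewrite VJ mxE (bigD1 (enum_val u)) //= mxE eqxx mulr1 big1 ?addr0 // => w wu.
  by rewrite mxE (negPf wu) mulr0.
have Vinj p (x : 'M[H]_(#|S|, p)) : V *m x = 0 -> x = 0.
  move=> Vx0; apply/matrixP => u c; rewrite mxE.
  have : J *m col c x = 0.
    apply: ((rindepP _ _).1 iS) => [j jS|]; first exact: JN.
    by rewrite !colE !mulmxA -VJ Vx0 mul0mx.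
  move=> /(congr1 (fun Y : 'cV[H]_q => Y (enum_val u) ord0)).
  by rewrite JE !mxE.
have [Y YV hF] := injective_projection (@Vinj _).
pose F := V *m Y; have FV : F *m V = V by rewrite -mulmxA YV mulmx1.
exists F, (J *m Y); split; last 2 first.
- by rewrite mulmxA -VJ.
- by rewrite qtrMC YV qtr1 cS.
- exact: hF.
apply/eqP; rewrite eq_sym -subr_eq0; apply/eqP/matrixP => i l; rewrite [RHS]mxE.
have [lS|lS] := boolP (l \in S).
  have -> : l = enum_val (enum_rank_in lS l) by rewrite enum_rankK_in.
  move: (enum_rank_in lS l) => u.
  transitivity (V i u - (F *m V) i u); last by rewrite FV subrr.
  rewrite !mxE VE; congr (_ - _).
  by apply: eq_bigr => k _; rewrite VE.
(* If [F] moved column [l], then [S] with [l] added would still be independent, against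
   maximality. *)
apply/eqP/negPn/negP => nz.
have : (#|l |: S| <= r)%N.
  apply: maxS; apply/rindepP => x xS Bx0.
  pose x' : 'cV[H]_q := \col_j (if j == l then 0 else x j ord0).
  have xE : x = x' + delta_mx l ord0 *m (x l ord0)%:M.
    apply/matrixP => j k; rewrite ord1 !mxE big_ord1 !mxE eqxx andbT mulr1n.
    by case: eqP => [->|_]; rewrite ?add0r ?mul1r // mul0r addr0.
  have x'S j : j \notin S -> x' j ord0 = 0.
    move=> jS; rewrite mxE; case: eqP => // /eqP jl; apply: xS.
    by rewrite !inE negb_or jl.
  have x'J : x' = J *m \col_u x' (enum_val u) ord0.
    apply/matrixP => j k; rewrite ord1; have [jS|jS] := boolP (j \in S).
      have -> : j = enum_val (enum_rank_in jS j) by rewrite enum_rankK_in.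
      by rewrite JE [RHS]mxE.
    by rewrite x'S // JN.
  (* The part [x'] of [x] supported in [S] is killed, so only the coefficient at [l] remains. *)
  have Bx' : (B - F *m B) *m x' = 0.
    by rewrite mulmxBl -mulmxA {1 2}x'J !mulmxA -!(mulmxA F) -VJ mulmxA FV subrr.
  have : (B - F *m B) *m x = 0 by rewrite mulmxBl -mulmxA Bx0 mulmx0 subrr.
  rewrite {1}xE mulmxDr Bx' add0r mulmxA -colE.
  move=> /(congr1 (fun Y : 'cV[H]_n => Y i ord0)).
  rewrite [LHS]mxE big_ord1 !mxE eqxx mulr1n => h.
  have xl : x l ord0 = 0 by apply: (qmul_eq0_r nz); rewrite !mxE.
  apply: ((rindepP _ _).1 iS) => // j jS; have [->//|jl] := eqVneq j l.
  by apply: xS; rewrite !inE negb_or jl.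
by rewrite cardsU1 lS cS ltnn.
Qed.

(** The projection [E] built from the largest order [s] and the projection [F] onto the columns of
    [B] are Hermitian with the same range, hence equal; their traces are [s] and [r]. *)
Lemma minors_adj_rank n q (G : 'M[H]_n) (B : 'M[H]_(n, q)) r Z Z' :
  hermq G -> qrank_is B r -> G = B *m Z -> B = G *m Z' ->
  sum_pminors G r != 0 /\
  minors_adj G r *m G *m G = (qreal (sum_pminors G r))%:M *m G.
Proof.
move=> hG rB GB BG; have [F [Y [hF FB FE trF]]] := column_projection rB.
have [s ds d0] := largest_pminor hG; set E := G *m herm_inv G s.
have hE : hermq E := hermq_herm_invM s hG.
have EG : E *m G = G := herm_invMK hG ds d0.
have EF : E *m F = F by rewrite FE BG !mulmxA EG.
have FE' : F *m E = E by rewrite /E GB !mulmxA FB.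
have eqFE : E = F by rewrite -FE' -{1}hF -hE -adjqM EF.
have : s%:R = r%:R :> R by rewrite -trF -eqFE qtr_herm_invM.
move/eqP; rewrite eqr_nat => /eqP <-; split; [exact: ds|exact: (minors_adjMM hG d0)].
Qed.

End RankProjection.

(** * Weighted inverses *)

Section WeightedInverse.
Variable R : rcfType.
Local Notation H := (quat R).

Lemma hermq_inverse n (C Ci : 'M[H]_n) : hermq C -> inverse_of C Ci -> hermq Ci.
Proof.
move=> hC [CCi _]; rewrite /hermq -[LHS]mulmx1 -CCi mulmxA -{1}hC -adjqM.
by rewrite CCi adjq1 mul1mx.
Qed.

Lemma qrank_is_ker m1 m2 n (A : 'M[H]_(m1, n)) (C : 'M[H]_(m2, n)) r :
  (forall x : 'cV[H]_n, A *m x = 0 <-> C *m x = 0) -> qrank_is A r -> qrank_is C r.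
Proof.
move=> AC.
have eqi S : rindep A S <-> rindep C S.
  by split=> /rindepP h; apply/rindepP => x xS /AC; apply: h.
case=> -[S [iS cS]] maxS; split; first by exists S; split=> //; apply/eqi.
by move=> T /eqi; apply: maxS.
Qed.

Section Left.
Variables (m n r : nat) (A : 'M[H]_(m, n)) (M : 'M[H]_m) (N Ninv : 'M[H]_n).
Variables (Y : 'M[H]_(n, m)) (Ash : 'M[H]_(n, m)) (G : 'M[H]_n).
Hypotheses (pM : posdefq M) (pN : posdefq N) (iN : inverse_of N Ninv).
Hypotheses (rA : qrank_is A r) (Yinv : wmp_inv M N A Y).
Hypotheses (AshE : Ash = Ninv *m adjq A *m M) (GE : G = Ash *m A) (hG : hermq G).

Let NG : N *m G = adjq A *m M *m A.
Proof. by rewrite GE AshE !mulmxA iN.1 mul1mx. Qed.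

(** [N G = A^* M A] is Hermitian, and so are both factors. *)
Let NGC : N *m G = G *m N.
Proof.
have [hM _] := pM; have [hN _] := pN.
by rewrite -[RHS]adjqK adjqM hN hG NG !adjqM adjqK hM mulmxA.
Qed.

Let NinvGC : Ninv *m G = G *m Ninv.
Proof.
by rewrite -[LHS]mulmx1 -iN.1 mulmxA -[Ninv *m G *m N]mulmxA -NGC mulmxA iN.2 mul1mx.
Qed.

Let kerGA p (X : 'M[H]_(n, p)) : G *m X = 0 -> A *m X = 0.
Proof.
move=> GX; apply: (posdefq_eq0 pM).
have -> : adjq (A *m X) *m M *m (A *m X) = adjq X *m (N *m G) *m X.
  by rewrite NG adjqM !mulmxA.
by rewrite -!mulmxA GX !mulmx0.
Qed.

(** [A] and [G] have the same kernel, hence the same rank, so [minors_adj_rank] applies to [G]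
    itself. With [Ash = G Y] and [Y = G W], the claim is [L r G G = d r G] multiplied by [W]. *)
Lemma minors_adj_weighted :
  sum_pminors G r != 0 /\
  minors_adj G r *m Ash = (qreal (sum_pminors G r))%:M *m Y.
Proof.
have rG : qrank_is G r.
  apply: qrank_is_ker rA => x; split=> [Ax|]; last exact: kerGA.
  by rewrite GE -mulmxA Ax mulmx0.
have [dr LGG] := minors_adj_rank hG rG (esym (mulmx1 G)) (esym (mulmx1 G)).
split; first exact: dr.
have [Gi [GC hGi hE GGG]] := herm_pinv hG.
have [YA1 YA2 YA3 YA4] := Yinv.
have AE : A = A *m (G *m Gi).
  apply/eqP; rewrite -subr_eq0 -{1}[A]mulmx1 -mulmxBr; apply/eqP/kerGA.
  by rewrite mulmxBr mulmx1 GC mulmxA GGG subrr.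
have AhE : adjq A = G *m Gi *m adjq A by rewrite {1}AE adjqM hE.
have YAE : Y *m A = Ninv *m adjq A *m adjq Y *m N.
  have [hN _] := pN.
  rewrite -[LHS]mul1mx -iN.2 -mulmxA [N *m _]mulmxA -YA4 -mulmxA.
  by rewrite !adjqM hN !mulmxA.
(* In [Y = Y A Y], the factor [Y A] is [Ninv A^* Y^* N]; since [A^* = G Gi A^*] and [Ninv] commutes
   with [G], a factor [G] moves to the front. *)
have [W YW] : exists W, Y = G *m W.
  exists (Ninv *m Gi *m adjq A *m adjq Y *m N *m Y).
  rewrite -{1}YA2 YAE {1}AhE !mulmxA.
  by rewrite NinvGC.
(* The third equation replaces [M A Y] by [Y^* A^* M], and [A Y A = A] then removes [Y]. *)
have AshGY : Ash = G *m Y.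
  have [hM _] := pM.
  have -> : G *m Y = Ninv *m adjq A *m (M *m A *m Y) by rewrite GE AshE !mulmxA.
  rewrite -YA3 !adjqM hM AshE -{1}YA1 !adjqM !mulmxA.
  exact: erefl.
by rewrite AshGY YW mulmxA mulmxA LGG -mulmxA.
Qed.

End Left.

Section Right.
Variables (p q r : nat) (B : 'M[H]_(p, q)) (P : 'M[H]_p) (Q Qinv : 'M[H]_q).
Variables (Y : 'M[H]_(q, p)) (Bsh : 'M[H]_(q, p)) (G : 'M[H]_p).
Hypotheses (pP : posdefq P) (pQ : posdefq Q) (iQ : inverse_of Q Qinv).
Hypotheses (rB : qrank_is B r) (Yinv : wmp_inv P Q B Y).
Hypotheses (BshE : Bsh = Qinv *m adjq B *m P) (GE : G = B *m Bsh) (hG : hermq G).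

Let hQi : hermq Qinv.
Proof. by have [hQ _] := pQ; apply: hermq_inverse iQ. Qed.

Let PGC : P *m G = G *m P.
Proof.
have [hP _] := pP.
rewrite -[RHS]adjqK adjqM hP hG GE BshE !adjqM adjqK hP hQi.
by rewrite !mulmxA.
Qed.

(** Here [B] and [G] have the same range, so [minors_adj_rank] applies to [B] directly. The rest
    mirrors the left case, with [Bsh = Y G] and [Y = W G]. *)
Lemma weighted_minors_adj :
  sum_pminors G r != 0 /\
  Bsh *m minors_adj G r = (qreal (sum_pminors G r))%:M *m Y.
Proof.
have [hP _] := pP; have [hQ _] := pQ.
have [Gi [GC hGi]] := herm_pinv hG.
have [E EE] : exists E, E = G *m Gi by exists (G *m Gi).
rewrite -EE => hE EG.
have [YB1 YB2 YB3 YB4] := Yinv.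
have [K KE] : exists K, K = 1%:M - E by exists (1%:M - E).
have GK : G *m K = 0 by rewrite KE mulmxBr mulmx1 EE GC mulmxA -EE EG subrr.
have hK : hermq K by rewrite KE /hermq adjqD adjqN adjq1 hE.
(* [K] projects onto the kernel of [G]. For [y = B^* P K], the form [y^* Qinv y] equals
   [K P G K = 0], and [Q] is positive definite. *)
have BPK : adjq B *m P *m K = 0.
  have [y yE] : exists y, y = adjq B *m P *m K by exists (adjq B *m P *m K).
  suff Qy : Qinv *m y = 0 by rewrite -yE -[y]mul1mx -iQ.1 -mulmxA Qy mulmx0.
  apply: (posdefq_eq0 pQ).
  have -> : adjq (Qinv *m y) *m Q *m (Qinv *m y) = adjq y *m Qinv *m y.
    by rewrite adjqM hQi -!mulmxA [Q *m _]mulmxA iQ.1 mul1mx.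
  have -> : adjq y *m Qinv *m y = K *m P *m (G *m K).
    rewrite yE !adjqM adjqK hP hK GE BshE !mulmxA.
    exact: erefl.
  by rewrite GK mulmx0.
(* The third equation turns [P B Y K] into [Y^* B^* P K], so [Y] vanishes on the kernel of [G]. *)
have YE : Y = Y *m E.
  apply/eqP; rewrite -subr_eq0 -{1}[Y]mulmx1 -mulmxBr -KE; apply/eqP.
  suff BYK : B *m Y *m K = 0 by rewrite -YB2 -!mulmxA [B *m _]mulmxA BYK mulmx0.
  apply: (posdefq_inj pP); rewrite !mulmxA -YB3 !adjqM hP -mulmxA.
  by rewrite BPK mulmx0.
have PEC : P *m E = E *m P.
  have PE : P *m E = G *m P *m Gi by rewrite EE mulmxA PGC.
  have EPE : E *m P *m E = P *m E by rewrite -mulmxA PE !mulmxA EG.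
  have := congr1 (@adjq R p p) EPE; rewrite !adjqM hE hP mulmxA EPE.
  exact.
(* [P K B = K P B] is the adjoint of [B^* P K = 0], so the columns of [B] lie in the range of
   [G]. *)
have BE : B = G *m (Gi *m B).
  rewrite mulmxA -EE; apply/eqP; rewrite -subr_eq0 -{1}[B]mul1mx -mulmxBl -KE.
  apply/eqP/(posdefq_inj pP).
  have PK : P *m K = K *m P by rewrite KE mulmxBr mulmxBl mulmx1 mul1mx PEC.
  by rewrite mulmxA PK -mulmxA -[LHS]adjqK adjqM [adjq (P *m B)]adjqM hP hK BPK adjq0.
have [dr LGG] := minors_adj_rank hG rB GE BE.
split; first exact: dr.
have YBQ : Y *m B *m Qinv = Qinv *m adjq B *m adjq Y.
  have YB : Y *m B = Qinv *m (Q *m Y *m B) by rewrite !mulmxA iQ.2 mul1mx.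
  by rewrite YB -YB4 !adjqM hQ -!mulmxA iQ.1 mulmx1.
(* By [YBQ], [Y G] is [Qinv] times the adjoint of [B Y B = B] times [P]. *)
have BshYG : Bsh = Y *m G.
  rewrite GE BshE !mulmxA YBQ -[in LHS]YB1 !adjqM !mulmxA.
  exact: erefl.
have [W YW] : exists W, Y = W *m G.
  by exists (Y *m Gi); rewrite {1}YE EE GC mulmxA.
have GGL : G *m (G *m minors_adj G r) = (qreal (sum_pminors G r))%:M *m G.
  by rewrite -(minors_adjC hG) mulmxA -(minors_adjC hG) LGG.
by rewrite BshYG YW -!mulmxA GGL mulmxA qreal_mxC -mulmxA.
Qed.

End Right.

End WeightedInverse.

(** With [L1] and [L2] the matrices [minors_adj] of [AA] at [r1] and of [BB] at [r2], every quotient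
    is an entry of [L1 Dt L2] over [Delta]: [dB] is a column of [Dt L2] and [dA] a row of [L1 Dt],
    so the two formulas of each case bracket this product in two ways. *)
Theorem theorem3p1 (R : rcfType) (m n p q : nat)
  (A : 'M[quat R]_(m, n)) (B : 'M[quat R]_(p, q)) (D : 'M[quat R]_(m, q))
  (M : 'M[quat R]_m) (N Ninv : 'M[quat R]_n)
  (P : 'M[quat R]_p) (Q Qinv : 'M[quat R]_q)
  (r1 r2 : nat) (YA : 'M[quat R]_(n, m)) (YB : 'M[quat R]_(q, p)) :
  posdefq M -> posdefq N -> posdefq P -> posdefq Q ->
  qrank_is A r1 -> (1 <= r1)%N -> qrank_is B r2 -> (1 <= r2)%N ->
  inverse_of N Ninv -> inverse_of Q Qinv ->
  wmp_inv M N A YA -> wmp_inv P Q B YB ->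
  let Ash := Ninv *m adjq A *m M in
  let Bsh := Qinv *m adjq B *m P in
  let AA := Ash *m A in
  let BB := B *m Bsh in
  hermq AA -> hermq BB ->
  let Dt := Ash *m D *m Bsh in
  let X := YA *m D *m YB in
  forall (i : 'I_n) (j : 'I_p),
  (* (i) *)
  ((r1 < n)%N -> (r2 < p)%N ->
     let dB := dB_sub BB Dt r2 j in
     let dA := dA_sub AA Dt r1 i in
     let Delta := sum_pminors AA r1 * sum_pminors BB r2 in
     X i j = (\sum_(b : {set 'I_n} | (#|b| == r1) && (i \in b))
                cdet_subq (colrep AA i dB) b i) * qreal (Delta^-1) /\
     X i j = (\sum_(a : {set 'I_p} | (#|a| == r2) && (j \in a))
                rdet_subq (rowrep BB j dA) a j) * qreal (Delta^-1)) /\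
  (* (ii) *)
  (r1 = n -> r2 = p ->
     let dB := dB_full BB Dt j in
     let dA := dA_full AA Dt i in
     let Delta := hdetq AA * hdetq BB in
     X i j = cdetq i (colrep AA i dB) * qreal (Delta^-1) /\
     X i j = rdetq j (rowrep BB j dA) * qreal (Delta^-1)) /\
  (* (iii) *)
  (r1 = n -> (r2 < p)%N ->
     let dB := dB_sub BB Dt r2 j in
     let dA := dA_full AA Dt i in
     let Delta := hdetq AA * sum_pminors BB r2 in
     X i j = cdetq i (colrep AA i dB) * qreal (Delta^-1) /\
     X i j = (\sum_(a : {set 'I_p} | (#|a| == r2) && (j \in a))
                rdet_subq (rowrep BB j dA) a j) * qreal (Delta^-1)) /\
  (* (iv) *)
  ((r1 < n)%N -> r2 = p ->
     let dB := dB_full BB Dt j in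
     let dA := dA_sub AA Dt r1 i in
     let Delta := sum_pminors AA r1 * hdetq BB in
     X i j = rdetq j (rowrep BB j dA) * qreal (Delta^-1) /\
     X i j = (\sum_(b : {set 'I_n} | (#|b| == r1) && (i \in b))
                cdet_subq (colrep AA i dB) b i) * qreal (Delta^-1)).
Proof.
move=> pM pN pP pQ rA _ rB _ iN iQ wA wB Ash Bsh AA BB hA hB Dt X i j.
have [dA LA] : sum_pminors AA r1 != 0 /\
    minors_adj AA r1 *m Ash = (qreal (sum_pminors AA r1))%:M *m YA.
  exact: (minors_adj_weighted pM pN iN rA wA erefl erefl hA).
have [dB LB] : sum_pminors BB r2 != 0 /\
    Bsh *m minors_adj BB r2 = (qreal (sum_pminors BB r2))%:M *m YB.
  exact: (weighted_minors_adj pP pQ iQ rB wB erefl erefl hB).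
clearbody AA BB.
have DtE : Dt = Ash *m D *m Bsh by [].
have XE0 : X = YA *m D *m YB by [].
clearbody Dt X Ash Bsh.
have [L1 L1E] : exists L1, L1 = minors_adj AA r1 by exists (minors_adj AA r1).
have [L2 L2E] : exists L2, L2 = minors_adj BB r2 by exists (minors_adj BB r2).
rewrite -L1E in LA; rewrite -L2E in LB.
pose Delta := sum_pminors AA r1 * sum_pminors BB r2.
have XE : X i j = (L1 *m Dt *m L2) i j * qreal Delta^-1.
  have -> : L1 *m Dt *m L2 = (qreal Delta)%:M *m X.
    have -> : L1 *m Dt *m L2 = (L1 *m Ash) *m D *m (Bsh *m L2) by rewrite DtE !mulmxA.
    rewrite LA LB mulmxA qreal_mxC XE0 !mulmxA -scalar_mxM -qrealM mulrC.
    exact: erefl.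
  rewrite mul_scalar_mx mxE -qrealC mulrA -qrealM mulVf ?mul1r //.
  by rewrite mulf_neq0.
have XA (v : 'cV[quat R]_n) : v = col j (Dt *m L2) ->
    X i j = (L1 *m v) i ord0 * qreal Delta^-1.
  by move=> ->; rewrite XE !colE !mulmxA -colE [col _ _ _ _]mxE.
have XB (w : 'rV[quat R]_p) : w = row i (L1 *m Dt) ->
    X i j = (w *m L2) ord0 j * qreal Delta^-1.
  by move=> ->; rewrite XE -row_mul [row _ _ _ _]mxE.
have dBs : dB_sub BB Dt r2 j = col j (Dt *m L2).
  apply/matrixP => k l.
  by rewrite !mxE (sum_rdet_subq hB) -row_mul [row _ _ _ _]mxE L2E !mxE.
have dAs : dA_sub AA Dt r1 i = row i (L1 *m Dt).
  apply/matrixP => k l; rewrite !mxE (sum_cdet_subq hA) colE mulmxA -colE !mxE -L1E.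
  exact: erefl.
(* At full rank the whole index set is the only one of its size, so the sum over subsets is a single
   determinant. *)
have dBf : r2 = p -> dB_full BB Dt j = col j (Dt *m L2).
  move=> e; apply/matrixP => k l.
  by rewrite !mxE (rdetq_full hB) -row_mul [row _ _ _ _]mxE L2E e !mxE.
have dAf : r1 = n -> dA_full AA Dt i = row i (L1 *m Dt).
  move=> e; apply/matrixP => k l.
  by rewrite !mxE (cdetq_full hA) colE mulmxA -colE !mxE L1E e.
have full1 : r1 = n -> minors_adj AA n = L1 /\ hdetq AA = sum_pminors AA r1.
  by move=> e; rewrite (hdetq_full hA) L1E e.
have full2 : r2 = p -> minors_adj BB p = L2 /\ hdetq BB = sum_pminors BB r2.
  by move=> e; rewrite (hdetq_full hB) L2E e.
split; [|split; [|split]].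
- move=> _ _ /=; rewrite (sum_cdet_subq hA) (sum_rdet_subq hB) -L1E -L2E.
  by split; [apply: XA|apply: XB].
- move=> e1 e2 /=; rewrite (cdetq_full hA) (rdetq_full hB).
  have [-> ->] := full1 e1; have [-> ->] := full2 e2.
  by split; [apply: XA; apply: dBf|apply: XB; apply: dAf].
- move=> e1 _ /=; rewrite (cdetq_full hA) (sum_rdet_subq hB) -L2E.
  have [-> ->] := full1 e1.
  by split; [apply: XA|apply: XB; apply: dAf].
- move=> _ e2 /=; rewrite (rdetq_full hB) (sum_cdet_subq hA) -L1E.
  have [-> ->] := full2 e2.
  by split; [apply: XB|apply: XA; apply: dBf].
Qed.
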